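(* Let $\Omega$ be the tiling space $\Omega_\Phi$ of an aperiodic primitive FLC substitution $\Phi$ with expansion $\Lambda$. Let $\mathbb X$ be a compact metrizable space with a continuous $\mathbb R^n$-action which is locally free (there is a neighborhood $U$ of $0$ such that no $x\in U\setminus\{0\}$ has a fixed point in $\mathbb X$), and let $g:\Omega\to\mathbb X$ be a factor map (continuous, surjective, $\mathbb R^n$-equivariant) such that $g(T)=g(T')$ implies $g(\Phi(T))=g(\Phi(T'))$. Let $p$ be a puncture map. Then the set $$\mathcal O=\{x\in\mathbb R^n:\exists T,T'\in\Omega\text{ with }g(T)=g(T'),\ \tau\in T,\ \tau'\in T',\ \mathring\tau\cap\mathring\tau'\neq\emptyset,\ p(\tau)-p(\tau')=x\}$$ is finite.
   Context: Prototiles $\rho_1,\dots,\rho_k$ in $\mathbb R^n$, an expanding linear isomorphism $\Lambda$ (all eigenvalues of modulus $>1$), and a substitution $\Phi$ replacing each $\rho_i$ by a patch of translated prototiles with support $\Lambda(\rho_i)$ (extended to patches by $\Phi(\{\rho_{i(j)}+v_j\})=\bigcup_j(\Phi(\rho_{i(j)})+\Lambda v_j)$). $\Omega_\Phi$ is the set of tilings whose finite patches are all allowed (contained in a translate of some $\Phi^m(\rho_i)$), with translation action $T\mapsto T-v$ and the standard tiling metric; primitive, aperiodic ($T-v=T\Rightarrow v=0$) and FLC have their usual meaning, and then $\Omega_\Phi$ is compact and $\Phi$ is a homeomorphism of it satisfying $\Phi(T-v)=\Phi(T)-\Lambda v$. $\mathring\tau$ is the interior of the tile $\tau$. A puncture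 map assigns to each tile $\tau$ occurring in tilings of $\Omega$ a point $p(\tau)\in\tau$ with $p(\tau+v)=p(\tau)+v$. *)

(* Defs.v *)
From Stdlib Require Fin.
From Stdlib Require Export Reals List.
Open Scope R_scope.

Definition Rn (n : nat) := Fin.t n -> R.
Definition vzero {n} : Rn n := fun _ => 0.
Definition vadd {n} (u v : Rn n) : Rn n := fun i => u i + v i.
Definition vsub {n} (u v : Rn n) : Rn n := fun i => u i - v i.
Definition vscal {n} (c : R) (u : Rn n) : Rn n := fun i => c * u i.

Fixpoint finsum (n : nat) : (Fin.t n -> R) -> R :=
  match n return (Fin.t n -> R) -> R with
  | O => fun _ => 0
  | S m => fun f => f Fin.F1 + finsum m (fun i => f (Fin.FS i))
  end.

Definition vnorm {n} (u : Rn n) : R := sqrt (finsum n (fun i => u i * u i)).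
Definition vdist {n} (u v : Rn n) : R := vnorm (vsub u v).

Definition interior {n} (A : Rn n -> Prop) (x : Rn n) : Prop :=
  exists r, 0 < r /\ forall y, vdist y x < r -> A y.
Definition closure {n} (A : Rn n -> Prop) (x : Rn n) : Prop :=
  forall r, 0 < r -> exists y, A y /\ vdist y x < r.

Definition is_prototile {n} (A : Rn n -> Prop) : Prop :=
  (exists M, forall y, A y -> vnorm y <= M) /\
  (forall x, closure A x -> A x) /\
  (forall x, A x <-> closure (interior A) x) /\
  (exists x, interior A x).

(** Linear maps; expanding linear isomorphisms (every complex eigenvalue
    a+ib, with complex eigenvector u+iw, has modulus > 1). *)
Definition is_linear {n} (L : Rn n -> Rn n) : Prop :=
  (forall u v, L (vadd u v) = vadd (L u) (L v)) /\
  (forall c u, L (vscal c u) = vscal c (L u)).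

Definition expanding_iso {n} (L : Rn n -> Rn n) : Prop :=
  is_linear L /\
  (forall u v, L u = L v -> u = v) /\
  (forall w, exists u, L u = w) /\
  (forall (a b : R) (u w : Rn n),
      (u <> vzero \/ w <> vzero) ->
      L u = vsub (vscal a u) (vscal b w) ->
      L w = vadd (vscal b u) (vscal a w) ->
      1 < a * a + b * b).

(** A tile is a translated prototile rho_i + v, represented by the label i
    and the translation vector v. *)
Definition tile (k n : nat) := (Fin.t k * Rn n)%type.
Definition tset (k n : nat) := tile k n -> Prop.

Definition support {k n} (rho : Fin.t k -> Rn n -> Prop) (t : tile k n)
  : Rn n -> Prop := fun y => rho (fst t) (vsub y (snd t)).

Definition translate {k n} (t : tile k n) (v : Rn n) : tile k n :=
  (fst t, vadd (snd t) v).

Definition tminus {k n} (T : tset k n) (v : Rn n) : tset k n :=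
  fun t => T (fst t, vadd (snd t) v).

Definition is_tiling {k n} (rho : Fin.t k -> Rn n -> Prop) (T : tset k n) : Prop :=
  (forall x, exists t, T t /\ support rho t x) /\
  (forall t t' x, T t -> T t' -> t <> t' ->
     interior (support rho t) x -> interior (support rho t') x -> False).

Definition is_substitution {k n} (rho : Fin.t k -> Rn n -> Prop)
  (L : Rn n -> Rn n) (phi : Fin.t k -> list (tile k n)) : Prop :=
  forall i,
    (forall y, (exists t, In t (phi i) /\ support rho t y) <->
               (exists z, rho i z /\ y = L z)) /\
    NoDup (phi i) /\
    (forall t t' y, In t (phi i) -> In t' (phi i) -> t <> t' ->
       interior (support rho t) y -> interior (support rho t') y -> False).

Definition PhiSet {k n} (L : Rn n -> Rn n) (phi : Fin.t k -> list (tile k n))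
  (S : tset k n) : tset k n :=
  fun t => exists i v u, S (i, v) /\ In (fst t, u) (phi i) /\ snd t = vadd u (L v).

Definition supertile {k n} (L : Rn n -> Rn n) (phi : Fin.t k -> list (tile k n))
  (m : nat) (i : Fin.t k) : tset k n :=
  Nat.iter m (PhiSet L phi) (fun t => t = (i, vzero)).

Definition allowed {k n} (L : Rn n -> Rn n) (phi : Fin.t k -> list (tile k n))
  (P : list (tile k n)) : Prop :=
  exists m i u, forall t, In t P -> supertile L phi m i (fst t, vsub (snd t) u).

Definition Omega {k n} (rho : Fin.t k -> Rn n -> Prop) (L : Rn n -> Rn n)
  (phi : Fin.t k -> list (tile k n)) (T : tset k n) : Prop :=
  is_tiling rho T /\
  (forall P : list (tile k n), (forall t, In t P -> T t) -> allowed L phi P).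

Definition primitive_subst {k n} (L : Rn n -> Rn n) (phi : Fin.t k -> list (tile k n)) : Prop :=
  exists m, (0 < m)%nat /\ forall i j, exists v, supertile L phi m i (j, v).

Definition aperiodic {k n} (rho : Fin.t k -> Rn n -> Prop) (L : Rn n -> Rn n)
  (phi : Fin.t k -> list (tile k n)) : Prop :=
  forall T, Omega rho L phi T ->
    forall v, (forall t, tminus T v t <-> T t) -> v = vzero.

Definition meets {k n} (rho : Fin.t k -> Rn n -> Prop) (t : tile k n)
  (x : Rn n) (r : R) : Prop :=
  exists y, support rho t y /\ vdist y x <= r.

Definition FLC {k n} (rho : Fin.t k -> Rn n -> Prop) (L : Rn n -> Rn n)
  (phi : Fin.t k -> list (tile k n)) : Prop :=
  forall r, 0 < r -> exists Ps : list (list (tile k n)),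
    forall T, Omega rho L phi T -> forall x, exists P u, In P Ps /\
      forall t, (T t /\ meets rho t x r) <-> In (fst t, vsub (snd t) u) P.

(** Neighbourhoods for the standard tiling metric: T and T' are delta-close
    if, after translations by less than delta, they agree on B(0, 1/delta). *)
Definition tclose {k n} (rho : Fin.t k -> Rn n -> Prop) (delta : R)
  (T T' : tset k n) : Prop :=
  exists u v, vnorm u < delta /\ vnorm v < delta /\
    forall t, meets rho t vzero (1 / delta) -> (tminus T u t <-> tminus T' v t).

Record MetricSpace := {
  mpt :> Type;
  mdist : mpt -> mpt -> R;
  mdist_nonneg : forall x y, 0 <= mdist x y;
  mdist_eq0 : forall x y, mdist x y = 0 <-> x = y;
  mdist_sym : forall x y, mdist x y = mdist y x;
  mdist_tri : forall x y z, mdist x z <= mdist x y + mdist y z }.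

Definition m_open (X : MetricSpace) (U : X -> Prop) : Prop :=
  forall x, U x -> exists r, 0 < r /\ forall y, mdist X x y < r -> U y.

Definition m_compact (X : MetricSpace) : Prop :=
  forall (I : Type) (U : I -> X -> Prop),
    (forall i, m_open X (U i)) -> (forall x, exists i, U i x) ->
    exists l : list I, forall x, exists i, In i l /\ U i x.

Definition continuous_action {n} (X : MetricSpace) (act : Rn n -> X -> X) : Prop :=
  (forall x, act vzero x = x) /\
  (forall u v x, act (vadd u v) x = act u (act v x)) /\
  (forall v x eps, 0 < eps -> exists delta, 0 < delta /\
     forall v' x', vdist v v' < delta -> mdist X x x' < delta ->
       mdist X (act v x) (act v' x') < eps).

Definition locally_free {n} (X : MetricSpace) (act : Rn n -> X -> X) : Prop :=
  exists r, 0 < r /\ forall v x, v <> vzero -> vnorm v < r -> act v x <> x.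

Definition factor_map {k n} (rho : Fin.t k -> Rn n -> Prop) (L : Rn n -> Rn n)
  (phi : Fin.t k -> list (tile k n)) (X : MetricSpace) (act : Rn n -> X -> X)
  (g : tset k n -> X) : Prop :=
  (forall x, exists T, Omega rho L phi T /\ g T = x) /\
  (forall T v, Omega rho L phi T -> g (tminus T v) = act v (g T)) /\
  (forall T eps, Omega rho L phi T -> 0 < eps -> exists delta, 0 < delta /\
     forall T', Omega rho L phi T' -> tclose rho delta T T' ->
       mdist X (g T) (g T') < eps).

Definition puncture {k n} (rho : Fin.t k -> Rn n -> Prop) (p : tile k n -> Rn n) : Prop :=
  (forall t, support rho t (p t)) /\
  (forall t v, p (translate t v) = vadd (p t) v).

Definition Oset {k n} (rho : Fin.t k -> Rn n -> Prop) (L : Rn n -> Rn n)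
  (phi : Fin.t k -> list (tile k n)) {X : MetricSpace} (g : tset k n -> X)
  (p : tile k n -> Rn n) (x : Rn n) : Prop :=
  exists T T', Omega rho L phi T /\ Omega rho L phi T' /\ g T = g T' /\
    exists t t', T t /\ T' t' /\
      (exists y, interior (support rho t) y /\ interior (support rho t') y) /\
      vsub (p t) (p t') = x.

(* Main.v *)
From Stdlib Require Import Reals List Lra Lia FunctionalExtensionality PropExtensionality ClassicalEpsilon.
From mathcomp Require all_boot all_order all_algebra complex Rstruct.
Require Import Defs.
Open Scope R_scope.

(** The heart of the matter is a rigidity of the fibers of [g]: there are [r0, e0 > 0] such
    that if [g T = g T'], [g S = g S'], [T] and [S] agree on the ball of radius [r0], and [T']
    and [S' - v] agree there with [|v| < e0], then [v = 0].  Otherwise choose [m] such that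
    [w = L^m v] has norm between [a] and [b], where [a > 0] and local freeness holds up to
    norm [b].  The patches on which the tilings agree still cover a large ball after
    [Phi^m], so uniform continuity of [g] gives
    [g (Phi^m S) ~ g (Phi^m T) = g (Phi^m T') ~ g (Phi^m S') - w = g (Phi^m S) - w],
    whereas by compactness of [Omega] no point of [X] is moved that little by a vector [w]
    of such norm.

    Now a displacement [x = p t - p t'] is bounded, and by FLC there are finitely many
    patches of radius [r1] around [p t] and around [p t'], up to translation.  Two
    displacements with the same pair of patches and at distance less than [e0] are equal
    by rigidity, so finitely many occur. *)

(** * Orbits of an expanding linear map *)

Module Spectral.
Import all_boot all_order all_algebra complex Rstruct.
Import Order.TTheory GRing.Theory Num.Theory.
Local Open Scope ring_scope.

Section ClosedField.
Variables (C : numClosedFieldType) (n : nat) (A : 'M[C]_n.+1).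
Hypothesis A_exp : forall a, eigenvalue A a -> 1 < `|a|.

(** Over a closed field the characteristic polynomial splits, its roots are eigenvalues, and
    Cayley-Hamilton makes the product vanish at [A]. Both orbit lemmas below induct on this list of
    factors, which replaces a Jordan form. *)
Lemma char_poly_expanding :
  exists s : seq C, all (fun z => 1 < `|z|) s /\
    horner_mx A (\prod_(z <- s) ('X - z%:P)) = 0.
Proof.
have [s Es] := closed_field_poly_normal (char_poly A).
rewrite (monicP (char_poly_monic A)) scale1r in Es.
exists s; split; last by rewrite -Es Cayley_Hamilton.
apply/allP => z zs; apply: A_exp.
by rewrite eigenvalue_root_char Es root_prod_XsubC.
Qed.

(** Peels off one factor: if the longer product annihilates an orbit [x], then the shorter one
    annihilates the orbit [x *m A - z *: x], to which the induction hypothesis applies. *)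
Lemma horner_mx_cons z (s : seq C) (x : 'rV[C]_n.+1) :
  x *m horner_mx A (\prod_(y <- z :: s) ('X - y%:P)) =
  (x *m A - z *: x) *m horner_mx A (\prod_(y <- s) ('X - y%:P)).
Proof.
rewrite big_cons rmorphM rmorphB /= horner_mx_X horner_mx_C -mulmxE mulmxA.
by rewrite mulmxBr mul_mx_scalar.
Qed.

(* Factor by factor: if [y m = x m (A - z)] is bounded then so is [x],
   since [z * x (m+1) = x m - y (m+1)] and [1 < |z|]. *)
Lemma backward_orbit_bounded (x : nat -> 'rV[C]_n.+1) :
  (forall m, x m.+1 *m A = x m) -> exists M, forall m j, `|x m 0 j| <= M.
Proof.
have [s [s1 s0]] := char_poly_expanding.
have : forall m, x m *m horner_mx A (\prod_(z <- s) ('X - z%:P)) = 0.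
  by move=> m; rewrite s0 mulmx0.
elim: s s1 {s0} x => [_|z s IHs /= /andP[z1 s1]] x xs xA.
  exists 0 => m j; move: (xs m).
  by rewrite big_nil rmorph1 mulmx1 => ->; rewrite mxE normr0.
pose y m := x m *m A - z *: x m.
have [] := IHs s1 y.
- by move=> m; rewrite -horner_mx_cons xs.
- by move=> m; rewrite /y mulmxBl -scalemxAl !xA.
move=> Y yY.
have [X0 x0] : exists X0, forall j, `|x 0%N 0 j| <= X0.
  exists (\sum_j `|x 0%N 0 j|) => j.
  by rewrite (bigD1 j) //= lerDl sumr_ge0.
have Y_ge0 : 0 <= Y by apply: le_trans (yY 0%N 0).
have X_ge0 : 0 <= X0 by apply: le_trans (x0 0).
have z_gt0 : 0 < `|z| - 1 by rewrite subr_gt0.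
(* [M] dominates the initial row and satisfies [M + Y <= |z| * M], which is what the induction on
   [m] needs after dividing by [|z|]. *)
pose M := X0 + Y / (`|z| - 1).
have MY : M + Y <= `|z| * M.
  rewrite -[`|z|](subrK 1) mulrDl mul1r addrC lerD2r /M mulrDr.
  rewrite [X in _ + X]mulrC divfK ?gt_eqF // lerDr.
  by rewrite mulr_ge0 // ltW.
exists M; elim=> [|m IHm] j.
  by apply: le_trans (x0 j) _; rewrite lerDl divr_ge0 // ltW.
have z0 : 0 < `|z| by apply: lt_trans z1.
rewrite -(ler_pM2l z0) -normrM; apply: le_trans MY.
have -> : z * x m.+1 0 j = x m 0 j - y m.+1 0 j.
  by rewrite /y xA !mxE opprB addrC subrK.
by apply: le_trans (ler_normB _ _) _; rewrite lerD.
Qed.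

(* Again factor by factor: a bounded [x] with [x (m+1) = z * x m] vanishes. *)
Lemma bounded_forward_orbit (C_archi : forall c : C, 0 <= c -> exists q : nat, c <= q%:R)
    (x : nat -> 'rV[C]_n.+1) M :
  (forall m, x m.+1 = x m *m A) -> (forall m j, `|x m 0 j| <= M) ->
  forall m, x m = 0.
Proof.
have [s [s1 s0]] := char_poly_expanding.
have : forall m, x m *m horner_mx A (\prod_(z <- s) ('X - z%:P)) = 0.
  by move=> m; rewrite s0 mulmx0.
elim: s s1 {s0} x M => [_|z s IHs /= /andP[z1 s1]] x M xs xA xM.
  by move=> m; move: (xs m); rewrite big_nil rmorph1 mulmx1.
pose y m := x m *m A - z *: x m.
have y0 : forall m, y m = 0.
  apply: (IHs s1 y (M + `|z| * M)).
  - by move=> m; rewrite -horner_mx_cons xs.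
  - by move=> m; rewrite /y mulmxBl -scalemxAl !xA.
  move=> m j; rewrite /y -xA !mxE.
  apply: le_trans (ler_normB _ _) _; rewrite lerD // normrM.
  by rewrite ler_pM // normr_ge0.
have xz m : x m.+1 = z *: x m by rewrite xA; apply/eqP; rewrite -subr_eq0 -/(y m) y0.
move=> m; apply/rowP => j; rewrite mxE; apply/eqP; rewrite -normr_le0.
have xpow q : x (q + m)%N = z ^+ q *: x m.
  by elim: q => [|q IHq]; rewrite ?scale1r // addSn xz IHq scalerA exprS.
apply/negPn/negP => xj_pos.
have a0 : 0 < `|x m 0 j| by rewrite normr_gt0 -normr_le0.
pose d := `|z| - 1.
have d0 : 0 < d by rewrite subr_gt0.
have zd : `|z| = 1 + d by rewrite addrC subrK.
(* Bernoulli's inequality: a nonzero coordinate of [x m] would grow at least linearly along the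
   orbit, against the bound [M]. *)
have bernoulli q : 1 + q%:R * d <= `|z| ^+ q.
  elim: q => [|q IHq]; first by rewrite mul0r addr0 expr0.
  rewrite exprS {1}zd mulrDl mul1r -natr1 mulrDl mul1r addrA lerD //.
  rewrite -[X in X <= _]mulr1 ler_pM2l //; apply: le_trans IHq.
  by rewrite lerDl mulr_ge0 // ltW.
have ad0 : 0 < d * `|x m 0 j| by rewrite mulr_gt0.
have M0 : 0 <= M by apply: le_trans (xM 0%N 0).
(* This [q] makes the term [q * d * |x m 0 j|] alone reach [M]; the summand 1 in Bernoulli then
   forces [|x m 0 j| <= 0]. *)
have [q Mq] := C_archi (M / (d * `|x m 0 j|)) (divr_ge0 M0 (ltW ad0)).
rewrite ler_pdivrMr // in Mq.
have: (1 + q%:R * d) * `|x m 0 j| <= M.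
  apply: le_trans (xM (q + m)%N j).
  by rewrite xpow mxE normrM normrX ler_pM2r // bernoulli.
rewrite mulrDl mul1r -mulrA => Mq'.
have := le_trans Mq' Mq; rewrite gerDr => /(lt_le_trans a0).
by rewrite ltxx.
Qed.

End ClosedField.

(** * Passage from real vectors to complex row vectors *)

Section Coordinates.
Variables (n : nat) (L : Rn n.+1 -> Rn n.+1).

Definition ord_fin (i : 'I_n.+1) : Fin.t n.+1 := Fin.of_nat_lt (elimT ssrnat.ltP (ltn_ord i)).
Definition fin_ord (k : Fin.t n.+1) : 'I_n.+1 :=
  Ordinal (introT ssrnat.ltP (proj2_sig (Fin.to_nat k))).

Lemma fin_ordK k : ord_fin (fin_ord k) = k.
Proof. by rewrite -[RHS]Fin.of_nat_to_nat_inv; apply: Fin.of_nat_ext. Qed.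

Lemma ord_finK i : fin_ord (ord_fin i) = i.
Proof. by apply: val_inj; rewrite /= Fin.to_nat_of_nat. Qed.

Definition basis_vec (i : 'I_n.+1) : Rn n.+1 := fun k => (fin_ord k == i)%:R.

Definition real_row (u : Rn n.+1) : 'rV[R[i]]_n.+1 := \row_j (u (ord_fin j))%:C%C.

(** Row [i] is the image of the basis vector [i], the transpose of the usual convention, so that [L]
    becomes multiplication of rows on the right. *)
Definition lin_mx : 'M[R[i]]_n.+1 :=
  \matrix_(i, j) (L (basis_vec i) (ord_fin j))%:C%C.

Lemma linear_coordE : is_linear L -> forall (u : Rn n.+1) k,
  L u k = \sum_i u (ord_fin i) * L (basis_vec i) k.
Proof.
move=> [LD LZ] u k.
have L_sum (c : 'I_n.+1 -> R) (r : seq 'I_n.+1) :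
    L (fun q => \sum_(i <- r) c i * basis_vec i q) k =
    \sum_(i <- r) c i * L (basis_vec i) k.
  elim: r => [|i r IHr].
    rewrite big_nil; have -> : (fun q : Fin.t n.+1 => \sum_(i <- [::]) c i * basis_vec i q)
      = vscal 0 vzero.
      by apply: functional_extensionality => q; rewrite big_nil /vscal RmultE mul0r.
    by rewrite LZ /vscal RmultE mul0r.
  rewrite big_cons -IHr.
  have -> : (fun q => \sum_(j <- i :: r) c j * basis_vec j q) =
     vadd (vscal (c i) (basis_vec i)) (fun q => \sum_(j <- r) c j * basis_vec j q).
    by apply: functional_extensionality => q; rewrite big_cons.
  by rewrite LD LZ.
rewrite -L_sum; congr (L _ k); apply: functional_extensionality => q.
rewrite (bigD1 (fin_ord q)) //= /basis_vec eqxx mulr1 fin_ordK big1 ?addr0 //.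
by move=> i /negPf; rewrite eq_sym => ->; rewrite mulr0.
Qed.

Lemma real_row_lin : is_linear L -> forall u,
  real_row (L u) = real_row u *m lin_mx.
Proof.
move=> linL u; apply/rowP => j; rewrite !mxE linear_coordE // rmorph_sum.
by apply: eq_bigr => i _; rewrite !mxE rmorphM.
Qed.

Definition part (f : R[i] -> R) (v : 'rV[R[i]]_n.+1) : Rn n.+1 :=
  fun k => f (v 0 (fin_ord k)).

(** Meant for [f] the real or the imaginary part: [lin_mx] has real entries, so taking parts
    commutes with it. *)
Lemma lin_part (f : R[i] -> R) : is_linear L ->
  (forall x y, f (x + y) = f x + f y) -> f 0 = 0 ->
  (forall x c, f (x * c%:C%C) = f x * c) ->
  forall v, L (part f v) = part f (v *m lin_mx).
Proof.
move=> linL fD f0 fZ v; apply: functional_extensionality => k.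
rewrite linear_coordE // /part mxE (big_morph f fD f0).
by apply: eq_bigr => i _; rewrite mxE fZ fin_ordK ord_finK.
Qed.

(** The real and imaginary parts of a complex eigenvector are exactly the vectors [u] and [w]
    quantified over in [expanding_iso]; moduli are compared through their squares. *)
Lemma lin_mx_expanding : expanding_iso L ->
  forall a, eigenvalue lin_mx a -> 1 < `|a|.
Proof.
move=> [linL [_ [_ expL]]] a /eigenvalueP[v vA v0].
rewrite -(@expr_gt1 _ 2) // -add_Re2_Im2 -[1]/(1%:C%C) ltcR.
have LRe := lin_part (@complex.Re R) linL.
have LIm := lin_part (@complex.Im R) linL.
apply/RltP; rewrite !expr2 -!RmultE -RplusE.
apply: (expL _ _ (part (@complex.Re R) v) (part (@complex.Im R) v)).
- apply: Classical_Prop.NNPP => uw0; case/negP: v0; apply/eqP/rowP => j.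
  rewrite mxE -(ord_finK j); apply/eqP; rewrite eq_complex; apply/andP; split.
    apply/eqP; apply: Classical_Prop.NNPP => nz; apply: uw0; left.
    by move=> /(congr1 (fun u => u (ord_fin j))) E; apply: nz; exact: E.
  apply/eqP; apply: Classical_Prop.NNPP => nz; apply: uw0; right.
  by move=> /(congr1 (fun u => u (ord_fin j))) E; apply: nz; exact: E.
- rewrite LRe //; last 2 first.
  + by case=> ? ? [].
  + by case=> x1 x2 c /=; rewrite mulr0 subr0.
  rewrite vA; apply: functional_extensionality => k; rewrite /part mxE.
  by rewrite /vsub /vscal; case: a {vA} => ? ?; case: (v _ _) => ? ?.
- rewrite LIm //; last 2 first.
  + by case=> ? ? [].
  + by case=> x1 x2 c /=; rewrite mulr0 add0r.
  rewrite vA; apply: functional_extensionality => k; rewrite /part mxE.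
  by rewrite /vadd /vscal; case: a {vA} => ? ?; case: (v _ _) => ? ? /=; rewrite addrC.
Qed.

End Coordinates.

Lemma expanding_backward_bounded n (L : Rn n -> Rn n) (x : nat -> Rn n) :
  expanding_iso L -> (forall m, L (x m.+1) = x m) ->
  exists M, forall m i, Rle (Rabs (x m i)) M.
Proof.
(* The matrix lemmas are stated in size [n.+1]; in dimension 0 there is no coordinate to bound. *)
case: n L x => [|n] L x expL Lx; first by exists 0 => m i; inversion i.
have [linL _] := expL.
have [m|M xM] := backward_orbit_bounded _ _ _ (lin_mx_expanding _ _ expL)
  (fun m => real_row _ (x m)).
  by rewrite -real_row_lin // Lx.
exists (complex.Re M) => m i; apply/RleP; rewrite RabsE -lecR.
have := le_trans (normc_ge_Re _) (xM m (fin_ord _ i)).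
by rewrite mxE /= fin_ordK lecE /= => /andP[_ ?]; rewrite lecR.
Qed.

Lemma expanding_forward_unbounded n (L : Rn n -> Rn n) (x : nat -> Rn n) M :
  expanding_iso L -> (forall m, x m.+1 = L (x m)) ->
  (forall m i, Rle (Rabs (x m i)) M) -> x 0%N = vzero.
Proof.
case: n L x => [|n] L x expL Lx xM.
  by apply: functional_extensionality => i; inversion i.
have [linL _] := expL.
(* In the order of [R[i]] a nonnegative element is real, so the Archimedean property comes from
   [R]. *)
have archi (c : R[i]) : 0 <= c -> exists q : nat, c <= q%:R.
  move=> c0; exists (Num.bound (complex.Re c)).
  have /andP[/eqP c_im c_re] : (complex.Im c == 0) && (0 <= complex.Re c).
    by move: c0; rewrite lecE.
  have := ltW (archi_boundP c_re); rewrite -lecR rmorph_nat.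
  by apply: le_trans; rewrite lecE /= c_im eqxx lexx.
have x0 : real_row _ (x 0%N) = 0.
  apply: (bounded_forward_orbit _ _ _ (lin_mx_expanding _ _ expL) archi
    (fun m => real_row _ (x m)) M%:C%C _ _ 0%N) => [m|m j].
    by rewrite -real_row_lin // Lx.
  rewrite mxE normc_def /= expr0n addr0 sqrtr_sqr lecR -RabsE.
  exact/RleP.
apply: functional_extensionality => i.
have /rowP/(_ (fin_ord _ i)) := x0.
by rewrite !mxE fin_ordK => -[].
Qed.

End Spectral.

(** * The Euclidean norm, by induction on the dimension *)

Ltac vec_ring :=
  apply functional_extensionality; intro;
  unfold vsub, vadd, vscal, vzero; try ring.

Lemma Rabs_le_elim x b : Rabs x <= b -> - b <= x <= b.
Proof. unfold Rabs; destruct (Rcase_abs x); lra. Qed.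

Lemma finsum_nonneg n (f : Fin.t n -> R) : (forall i, 0 <= f i) -> 0 <= finsum n f.
Proof.
  induction n as [|n IH]; intros Hf; simpl; [lra|].
  specialize (IH (fun i => f (Fin.FS i)) (fun i => Hf (Fin.FS i))).
  specialize (Hf Fin.F1). lra.
Qed.

Lemma vnorm_sqr n (u : Rn n) : vnorm u * vnorm u = finsum n (fun i => u i * u i).
Proof.
  apply sqrt_sqrt, finsum_nonneg; intro; nra.
Qed.

Lemma vnorm_nonneg n (u : Rn n) : 0 <= vnorm u.
Proof. apply sqrt_pos. Qed.

Lemma vnorm_le_of_sqr n (u : Rn n) M : 0 <= M -> vnorm u * vnorm u <= M * M -> vnorm u <= M.
Proof. intros; apply Rsqr_incr_0_var; assumption. Qed.

Definition vhead {n} (u : Rn (S n)) : R := u Fin.F1.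
Definition vtail {n} (u : Rn (S n)) : Rn n := fun i => u (Fin.FS i).
Definition vcons {n} (c : R) (u : Rn n) : Rn (S n) := fun i => Fin.caseS' i (fun _ => R) c u.

Lemma fin_S_ind n (P : Fin.t (S n) -> Prop) :
  P Fin.F1 -> (forall i, P (Fin.FS i)) -> forall i, P i.
Proof. intros H0 HS i; exact (Fin.caseS' i P H0 HS). Qed.

Lemma Rn_S_ext n (u v : Rn (S n)) : vhead u = vhead v -> vtail u = vtail v -> u = v.
Proof.
  intros H0 H1; apply functional_extensionality; intro i.
  revert i; apply fin_S_ind; [exact H0|].
  intro i; exact (f_equal (fun w => w i) H1).
Qed.

Lemma vnorm_0dim (u : Rn 0) : vnorm u = 0.
Proof. apply sqrt_0. Qed.

Lemma vnorm_S_sqr n (u : Rn (S n)) :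
  vnorm u * vnorm u = vhead u * vhead u + vnorm (vtail u) * vnorm (vtail u).
Proof. rewrite !vnorm_sqr; reflexivity. Qed.

Lemma vnorm_vhead n (u : Rn (S n)) : Rabs (vhead u) <= vnorm u.
Proof.
  apply Rsqr_incr_0_var; [|apply vnorm_nonneg].
  rewrite <- Rsqr_abs; unfold Rsqr; rewrite vnorm_S_sqr.
  assert (H := vnorm_nonneg _ (vtail u)); nra.
Qed.

Lemma vnorm_vtail n (u : Rn (S n)) : vnorm (vtail u) <= vnorm u.
Proof.
  apply vnorm_le_of_sqr; [apply vnorm_nonneg|].
  rewrite (vnorm_S_sqr _ u); nra.
Qed.

Lemma vnorm_coord n (u : Rn n) i : Rabs (u i) <= vnorm u.
Proof.
  induction n as [|n IH]; [inversion i|].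
  revert i; apply fin_S_ind; [apply vnorm_vhead|].
  intro i; apply Rle_trans with (vnorm (vtail u)); [exact (IH (vtail u) i)|apply vnorm_vtail].
Qed.

Lemma vnorm_cons_le n (u : Rn (S n)) : vnorm u <= Rabs (vhead u) + vnorm (vtail u).
Proof.
  assert (H1 := Rabs_pos (vhead u)); assert (H2 := vnorm_nonneg _ (vtail u)).
  apply vnorm_le_of_sqr; [lra|].
  rewrite vnorm_S_sqr; assert (H3 := Rsqr_abs (vhead u)); unfold Rsqr in H3; nra.
Qed.

Lemma vnorm_le_coords n (u : Rn n) M : (forall i, Rabs (u i) <= M) -> vnorm u <= INR n * M.
Proof.
  induction n as [|n IH]; intros H.
  - rewrite vnorm_0dim; simpl; lra.
  - rewrite S_INR; assert (H0 := H Fin.F1).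
    assert (H1 := IH (vtail u) (fun i => H (Fin.FS i))).
    assert (H2 := vnorm_cons_le _ u); unfold vhead in H2; lra.
Qed.

(** The planar triangle inequality behind the induction: [a], [b] are first coordinates and [p],
    [q], [r] norms of the remaining ones. Cauchy-Schwarz in the plane follows from
    [(a * q - b * p)^2 >= 0]. *)
Lemma minkowski2 a b p q r x y z :
  0 <= p -> 0 <= q -> 0 <= r -> 0 <= x -> 0 <= y ->
  x * x = a * a + p * p -> y * y = b * b + q * q -> r <= p + q ->
  z * z = (a + b) * (a + b) + r * r -> z * z <= (x + y) * (x + y).
Proof.
  intros Hp Hq Hr Hx Hy Ex Ey Hrpq Ez.
  assert (Hxy : a * b + p * q <= x * y).
  { destruct (Rle_dec (a * b + p * q) 0) as [Hneg|Hpos]; [nra|].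
    apply Rsqr_incr_0_var; [|nra]; unfold Rsqr.
    replace (x * y * (x * y)) with ((x * x) * (y * y)) by ring.
    rewrite Ex, Ey; assert (H := Rle_0_sqr (a * q - b * p)); unfold Rsqr in H; lra. }
  assert (r * r <= (p + q) * (p + q)) by nra. lra.
Qed.

Lemma vnorm_triangle n (u v : Rn n) : vnorm (vadd u v) <= vnorm u + vnorm v.
Proof.
  induction n as [|n IH]; [rewrite !vnorm_0dim; lra|].
  apply vnorm_le_of_sqr;
    [assert (H1 := vnorm_nonneg _ u); assert (H2 := vnorm_nonneg _ v); lra|].
  apply minkowski2 with (a := vhead u) (b := vhead v) (p := vnorm (vtail u))
    (q := vnorm (vtail v)) (r := vnorm (vtail (vadd u v)));
    try apply vnorm_nonneg; try apply vnorm_S_sqr.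
  exact (IH (vtail u) (vtail v)).
Qed.

Lemma finsum_scal n c (f : Fin.t n -> R) : finsum n (fun i => c * f i) = c * finsum n f.
Proof.
  induction n as [|n IH]; simpl; [ring|].
  rewrite (IH (fun i => f (Fin.FS i))); ring.
Qed.

Lemma vnorm_vscal n c (u : Rn n) : vnorm (vscal c u) = Rabs c * vnorm u.
Proof.
  apply Rsqr_inj; [apply vnorm_nonneg| |].
  { apply Rmult_le_pos; [apply Rabs_pos|apply vnorm_nonneg]. }
  unfold Rsqr; rewrite vnorm_sqr.
  replace (fun i => vscal c u i * vscal c u i) with (fun i => (c * c) * (u i * u i)).
  2: { apply functional_extensionality; intro; unfold vscal; ring. }
  rewrite finsum_scal, <- vnorm_sqr.
  assert (H := Rsqr_abs c); unfold Rsqr in H; rewrite H; ring.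
Qed.

Lemma vnorm_zero n : vnorm (vzero : Rn n) = 0.
Proof.
  replace (vzero : Rn n) with (vscal 0 (vzero : Rn n)) by vec_ring.
  rewrite vnorm_vscal, Rabs_R0; ring.
Qed.

Lemma vdist_sym n (u v : Rn n) : vdist u v = vdist v u.
Proof.
  unfold vdist; replace (vsub v u) with (vscal (-1) (vsub u v)) by vec_ring.
  rewrite vnorm_vscal, (Rabs_left (-1)) by lra; ring.
Qed.

Lemma vdist_tri n (u v w : Rn n) : vdist u w <= vdist u v + vdist v w.
Proof.
  unfold vdist; replace (vsub u w) with (vadd (vsub u v) (vsub v w)) by vec_ring.
  apply vnorm_triangle.
Qed.

Lemma vdist_refl n (u : Rn n) : vdist u u = 0.
Proof.
  unfold vdist; replace (vsub u u) with (vzero : Rn n) by vec_ring.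
  apply vnorm_zero.
Qed.

Lemma vdist_vzero n (u : Rn n) : vdist u vzero = vnorm u.
Proof. unfold vdist; f_equal; vec_ring. Qed.

Lemma vnorm_vsub_le n (u v : Rn n) : vnorm (vsub u v) <= vnorm u + vnorm v.
Proof.
  rewrite <- (vdist_vzero _ u), <- (vdist_vzero _ v), (vdist_sym _ v).
  apply vdist_tri.
Qed.

(** * Linear maps *)

Lemma linear_vzero n p (F : Rn n -> Rn p) :
  (forall c u, F (vscal c u) = vscal c (F u)) -> F vzero = vzero.
Proof.
  intro FZ; replace (vzero : Rn n) with (vscal 0 (vzero : Rn n)) by vec_ring.
  rewrite FZ; vec_ring.
Qed.

(** Banach-Steinhaus in finite dimension: the bounds on the finitely many basis vectors add up, one
    coordinate being split off at a time. It serves for a single map and for the family of all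
    iterates of an inverse. *)
Lemma uniform_boundedness n p (I : Type) (F : I -> Rn n -> Rn p) :
  (forall m u v, F m (vadd u v) = vadd (F m u) (F m v)) ->
  (forall m c u, F m (vscal c u) = vscal c (F m u)) ->
  (forall u, exists M, forall m, vnorm (F m u) <= M) ->
  exists M, 0 < M /\ forall m u, vnorm (F m u) <= M * vnorm u.
Proof.
  induction n as [|n IH]; intros FD FZ Fbd.
  - exists 1; split; [lra|]; intros m u.
    replace u with (vzero : Rn 0) by (apply functional_extensionality; intro i; inversion i).
    rewrite linear_vzero by apply FZ; rewrite !vnorm_zero; lra.
  - destruct (Fbd (vcons 1 vzero)) as [A HA].
    destruct (IH (fun m u => F m (vcons 0 u))) as [B [HB0 HB]].
    + intros m u v; rewrite <- FD; f_equal; apply Rn_S_ext;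
        [unfold vhead, vadd; simpl; ring|reflexivity].
    + intros m c u; rewrite <- FZ; f_equal; apply Rn_S_ext;
        [unfold vhead, vscal; simpl; ring|reflexivity].
    + intro u; apply Fbd.
    + exists (Rabs A + B); split; [assert (H := Rabs_pos A); lra|]; intros m u.
      replace (F m u) with (vadd (vscal (vhead u) (F m (vcons 1 vzero))) (F m (vcons 0 (vtail u)))).
      * eapply Rle_trans; [apply vnorm_triangle|]; rewrite vnorm_vscal.
        assert (H1 := vnorm_vhead _ u); assert (H2 := vnorm_vtail _ u).
        assert (H3 := HA m); assert (H4 := HB m (vtail u)); assert (H5 := Rle_abs A).
        assert (H6 := vnorm_nonneg _ (F m (vcons 1 vzero))); assert (H7 := Rabs_pos (vhead u)).
        assert (H8 := vnorm_nonneg _ (vtail u)); nra.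
      * rewrite <- FZ, <- FD; f_equal; apply Rn_S_ext;
          [unfold vhead, vadd, vscal; simpl; ring|].
        apply functional_extensionality; intro i; unfold vtail, vadd, vscal, vzero; simpl.
        unfold vzero; ring.
Qed.

Lemma linear_bounded n (L : Rn n -> Rn n) : is_linear L ->
  exists K, 0 < K /\ forall u, vnorm (L u) <= K * vnorm u.
Proof.
  intros [LD LZ].
  destruct (uniform_boundedness n n unit (fun _ => L)) as [K [K0 HK]];
    [intros; apply LD|intros; apply LZ| |].
  - intro u; exists (vnorm (L u)); intros _; apply Rle_refl.
  - exists K; split; [exact K0|exact (HK tt)].
Qed.

Lemma iter_add n (L : Rn n -> Rn n) (m : nat) : is_linear L ->
  forall u v, Nat.iter m L (vadd u v) = vadd (Nat.iter m L u) (Nat.iter m L v).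
Proof.
  intros [LD _] u v; induction m as [|m IH]; simpl; [reflexivity|now rewrite IH, LD].
Qed.

Lemma iter_scal n (L : Rn n -> Rn n) (m : nat) : is_linear L ->
  forall c u, Nat.iter m L (vscal c u) = vscal c (Nat.iter m L u).
Proof.
  intros [_ LZ] c u; induction m as [|m IH]; simpl; [reflexivity|now rewrite IH, LZ].
Qed.

Lemma iter_succ_inner A (f : A -> A) m x : Nat.iter (S m) f x = Nat.iter m f (f x).
Proof. induction m as [|m IH]; simpl; [reflexivity|now rewrite <- IH]. Qed.

(** Iterates of the inverse are pointwise bounded by the spectral result, hence uniformly bounded.
    Since [C] does not depend on [m], every [L^m] maps the ball of radius [C * q] onto a set
    containing the ball of radius [q], with no adapted norm involved. *)
Lemma expanding_preimage_bound n (L : Rn n -> Rn n) : expanding_iso L ->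
  exists C, 0 < C /\ forall m y, exists z, Nat.iter m L z = y /\ vnorm z <= C * vnorm y.
Proof.
  intro expL; pose proof expL as [linL [Linj [Lsurj _]]].
  set (B := fun w => proj1_sig (constructive_indefinite_description _ (Lsurj w))).
  assert (LB : forall w, L (B w) = w).
  { intro w; exact (proj2_sig (constructive_indefinite_description _ (Lsurj w))). }
  assert (linB : is_linear B).
  { destruct linL as [LD LZ]; split; intros; apply Linj;
      rewrite ?LD, ?LZ, !LB; reflexivity. }
  destruct (uniform_boundedness n n nat (fun m => Nat.iter m B)) as [C [C0 HC]].
  - intros m; apply iter_add, linB.
  - intros m; apply iter_scal, linB.
  - intro u.
    destruct (Spectral.expanding_backward_bounded n L (fun m => Nat.iter m B u)) as [M HM];
      [exact expL|intro; apply LB|].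
    exists (INR n * M); intro m; apply vnorm_le_coords, HM.
  - exists C; split; [exact C0|]; intros m y; exists (Nat.iter m B y); split; [|apply HC].
    induction m as [|m IH]; [reflexivity|].
    rewrite iter_succ_inner; simpl; rewrite LB; exact IH.
Qed.

Lemma expanding_orbit_escapes n (L : Rn n -> Rn n) (v : Rn n) r : expanding_iso L ->
  v <> vzero -> exists m, r <= vnorm (Nat.iter m L v).
Proof.
  intros expL Hv; apply Classical_Prop.NNPP; intro H; apply Hv.
  apply (Spectral.expanding_forward_unbounded n L (fun m => Nat.iter m L v) r expL).
  - reflexivity.
  - intros m i; apply Rle_trans with (vnorm (Nat.iter m L v)); [apply vnorm_coord|].
    destruct (Rle_dec r (vnorm (Nat.iter m L v))) as [H1|H1]; [|lra].
    exfalso; apply H; exists m; exact H1.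
Qed.

(** * Compactness *)

Lemma net_1d (a eps : R) (q : nat) : 0 < eps ->
  exists cs, forall x, a <= x <= a + INR q * eps -> exists c, In c cs /\ Rabs (x - c) <= eps.
Proof.
  intro He; induction q as [|q [cs Hcs]].
  - exists (a :: nil); intros x Hx; exists a; split; [now left|].
    simpl in Hx; apply Rabs_le; lra.
  - exists ((a + INR q * eps) :: cs); intros x Hx; rewrite S_INR in Hx.
    destruct (Rle_dec x (a + INR q * eps)) as [H|H].
    + destruct (Hcs x) as [c [H1 H2]]; [lra|]; exists c; split; [now right|exact H2].
    + exists (a + INR q * eps); split; [now left|]; apply Rabs_le; lra.
Qed.

Lemma net_cube n M eps : 0 < eps ->
  exists cs, forall u : Rn n, (forall i, Rabs (u i) <= M) ->
    exists c, In c cs /\ forall i, Rabs (u i - c i) <= eps.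
Proof.
  intro He; induction n as [|n [cs Hcs]].
  - exists (vzero :: nil); intros u _; exists vzero; split; [now left|intro i; inversion i].
  - destruct (INR_unbounded (2 * M / eps)) as [q Hq].
    destruct (net_1d (- M) eps q He) as [ds Hds].
    exists (flat_map (fun d => map (vcons d) cs) ds); intros u Hu.
    destruct (Hds (vhead u)) as [d [Hd1 Hd2]].
    { assert (H := Hu Fin.F1); apply Rabs_le_elim in H; unfold vhead.
      assert (2 * M = 2 * M / eps * eps) by (field; lra); nra. }
    destruct (Hcs (vtail u)) as [c [Hc1 Hc2]]; [intro i; apply Hu|].
    exists (vcons d c); split.
    + apply in_flat_map; exists d; split; [exact Hd1|apply in_map, Hc1].
    + apply fin_S_ind; [exact Hd2|exact Hc2].
Qed.

Lemma net_ball n M eps : 0 < eps ->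
  exists cs, forall u : Rn n, vnorm u <= M -> exists c, In c cs /\ vdist u c < eps.
Proof.
  intro He; assert (Hn := pos_INR n).
  destruct (net_cube n M (eps / (INR n + 1))) as [cs Hcs]; [apply Rdiv_lt_0_compat; lra|].
  exists cs; intros u Hu; destruct (Hcs u) as [c [H1 H2]].
  - intro i; eapply Rle_trans; [apply vnorm_coord|exact Hu].
  - exists c; split; [exact H1|].
    eapply Rle_lt_trans; [exact (vnorm_le_coords n (vsub u c) _ H2)|].
    apply Rmult_lt_reg_r with (INR n + 1); [lra|].
    replace (INR n * (eps / (INR n + 1)) * (INR n + 1)) with (INR n * eps) by (field; lra).
    nra.
Qed.

Definition infinite_set (A : nat -> Prop) : Prop := forall N : nat, exists j, (N <= j)%nat /\ A j.

Lemma infinite_pigeonhole C (l : list C) (c : nat -> C) (A : nat -> Prop) :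
  (forall j, In (c j) l) -> infinite_set A ->
  exists a, infinite_set (fun j => A j /\ c j = a).
Proof.
  intros Hl HA; apply Classical_Prop.NNPP; intro Hno.
  assert (Hbd : forall a, exists N, forall j, A j -> c j = a -> (j < N)%nat).
  { intro a; apply Classical_Prop.NNPP; intro Ha; apply Hno; exists a; intro N.
    apply Classical_Prop.NNPP; intro HN; apply Ha; exists N; intros j Hj Hc.
    destruct (Nat.lt_ge_cases j N) as [H|H]; [exact H|].
    exfalso; apply HN; exists j; auto. }
  assert (Hall : exists N, forall j, A j -> In (c j) l -> (j < N)%nat).
  { clear Hl; induction l as [|a l [N HN]]; [exists O; intros j _ []|].
    destruct (Hbd a) as [N' HN']; exists (N + N')%nat; intros j Hj [Hc|Hc].
    - assert (H := HN' j Hj (eq_sym Hc)); lia.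
    - assert (H := HN j Hj Hc); lia. }
  destruct Hall as [N HN]; destruct (HA N) as [j [H1 H2]].
  assert (H := HN j H2 (Hl j)); lia.
Qed.

Definition increasing (s : nat -> nat) : Prop := forall j, (s j < s (S j))%nat.

Lemma increasing_ge s : increasing s -> forall j, (j <= s j)%nat.
Proof. intros H j; induction j as [|j IH]; [lia|specialize (H j); lia]. Qed.

(** Cantor's diagonal argument: nested infinite index sets [As], where passing from [As m] to
    [As (S m)] makes the colouring [c m] constant by the pigeonhole principle. *)
Lemma diagonal_subsequence C (c : nat -> nat -> C) :
  (forall m, exists l, forall j, In (c m j) l) ->
  exists s, increasing s /\ forall m, exists a, forall j, (m <= j)%nat -> c m (s j) = a.
Proof.
  intro Hfin.
  assert (step : forall m (A : {A | infinite_set A}),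
    {a | infinite_set (fun j => proj1_sig A j /\ c m j = a)}).
  { intros m [A HA]; apply constructive_indefinite_description; simpl.
    destruct (Hfin m) as [l Hl]; exact (infinite_pigeonhole C l (c m) A Hl HA). }
  set (next := fun m A => exist infinite_set _ (proj2_sig (step m A))).
  set (As := fix As m := match m with
    | O => exist infinite_set (fun _ => True)
             (fun N => ex_intro _ N (conj (le_n N) Logic.I))
    | S m => next m (As m) end).
  assert (Amono : forall m j q, proj1_sig (As (q + m)%nat) j -> proj1_sig (As m) j).
  { intros m j q; induction q as [|q IH]; simpl; [auto|intros [H _]; auto]. }
  assert (pick : forall m N, {j | (N <= j)%nat /\ proj1_sig (As m) j}).
  { intros m N; apply constructive_indefinite_description, (proj2_sig (As m)). }
  (* The pick [s j] is taken in [As (S j)], on which the colourings 0 to [j] are already constant;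
     hence [c m] is constant from [j = m] on. *)
  set (s := fix s j := match j with
    | O => proj1_sig (pick 1%nat O)
    | S j => proj1_sig (pick (S (S j)) (S (s j))) end).
  exists s; split.
  - intro j; exact (proj1 (proj2_sig (pick (S (S j)) (S (s j))))).
  - intro m; exists (proj1_sig (step m (As m))); intros j Hj.
    assert (Hs : proj1_sig (As (S j)) (s j)).
    { destruct j as [|j]; [exact (proj2 (proj2_sig (pick _ _)))|].
      exact (proj2 (proj2_sig (pick (S (S j)) (S (s j))))). }
    assert (H : proj1_sig (As (S m)) (s j)).
    { apply (Amono (S m) (s j) (j - m)%nat).
      replace (j - m + S m)%nat with (S j) by lia; exact Hs. }
    exact (proj2 H).
Qed.

Definition converges {n} (v : nat -> Rn n) (w : Rn n) : Prop :=
  forall eps, 0 < eps -> exists J, forall j, (J <= j)%nat -> vdist (v j) w < eps.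

Lemma converges_coords n (v : nat -> Rn n) (w : Rn n) :
  (forall i, Un_cv (fun j => v j i) (w i)) -> converges v w.
Proof.
  intros H eps He; assert (Hn := pos_INR n).
  assert (Hd : 0 < eps / (INR n + 1)) by (apply Rdiv_lt_0_compat; lra).
  assert (HJ : exists J, forall j, (J <= j)%nat -> forall i, Rabs (v j i - w i) <= eps / (INR n + 1)).
  { clear He Hn; set (d := eps / (INR n + 1)) in *; clearbody d.
    revert v w H; induction n as [|n IH]; intros v w H.
    - exists O; intros j _ i; inversion i.
    - destruct (IH (fun j => vtail (v j)) (vtail w) (fun i => H (Fin.FS i))) as [J1 H1].
      destruct (H Fin.F1 d Hd) as [J2 H2]; exists (J1 + J2)%nat; intros j Hj.
      apply fin_S_ind; [|apply H1; lia].
      apply Rlt_le, H2; lia. }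
  destruct HJ as [J HJ]; exists J; intros j Hj.
  eapply Rle_lt_trans; [exact (vnorm_le_coords n (vsub (v j) w) _ (HJ j Hj))|].
  apply Rmult_lt_reg_r with (INR n + 1); [lra|].
  replace (INR n * (eps / (INR n + 1)) * (INR n + 1)) with (INR n * eps) by (field; lra).
  nra.
Qed.

(** Each index is coloured by a nearby point of a finite net of mesh [/ (INR m + 1)], for every [m];
    the diagonal subsequence is Cauchy in each coordinate. *)
Lemma bolzano_weierstrass n (v : nat -> Rn n) M :
  (forall j, vnorm (v j) <= M) ->
  exists s w, increasing s /\ converges (fun j => v (s j)) w.
Proof.
  intro Hv.
  assert (Hpos : forall m, 0 < / (INR m + 1)).
  { intro m; apply Rinv_0_lt_compat; assert (H := pos_INR m); lra. }
  assert (nets : forall m, {cs : list (Rn n) |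
     forall u, vnorm u <= M -> exists c, In c cs /\ vdist u c < / (INR m + 1)}).
  { intro m; apply constructive_indefinite_description, net_ball, Hpos. }
  assert (cell : forall m j, {c | In c (proj1_sig (nets m)) /\ vdist (v j) c < / (INR m + 1)}).
  { intros m j; apply constructive_indefinite_description, (proj2_sig (nets m)), Hv. }
  destruct (diagonal_subsequence (Rn n) (fun m j => proj1_sig (cell m j))) as [s [Hs Hc]].
  { intro m; exists (proj1_sig (nets m)); intro j; exact (proj1 (proj2_sig (cell m j))). }
  assert (Hcau : forall i, Cauchy_crit (fun j => v (s j) i)).
  { intros i eps He; destruct (INR_unbounded (2 / eps)) as [m Hm].
    destruct (Hc m) as [a Ha]; exists m.
    assert (Hd : forall j, (m <= j)%nat -> vdist (v (s j)) a < / (INR m + 1)).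
    { intros j Hj; rewrite <- (Ha j Hj); exact (proj2 (proj2_sig (cell m (s j)))). }
    intros j q Hj Hq; unfold Rdist.
    eapply Rle_lt_trans; [exact (vnorm_coord n (vsub (v (s j)) (v (s q))) i)|].
    eapply Rle_lt_trans; [exact (vdist_tri n (v (s j)) a (v (s q)))|].
    rewrite (vdist_sym _ a); assert (H1 := Hd j Hj); assert (H2 := Hd q Hq).
    assert (/ (INR m + 1) < eps / 2); [|lra].
    assert (0 < 2 / eps) by (apply Rdiv_lt_0_compat; lra).
    replace (eps / 2) with (/ (2 / eps)) by (field; lra).
    apply Rinv_lt_contravar; [apply Rmult_lt_0_compat|]; lra. }
  exists s, (fun i => proj1_sig (R_complete _ (Hcau i))); split; [exact Hs|].
  apply converges_coords; intro i; exact (proj2_sig (R_complete _ (Hcau i))).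
Qed.

(** * Tilings *)

Section Tilings.

Variables (n k : nat) (rho : Fin.t k -> Rn n -> Prop) (L : Rn n -> Rn n)
  (phi : Fin.t k -> list (tile k n)).

Hypothesis rho_prototile : forall i, is_prototile (rho i).
Hypothesis L_expanding : expanding_iso L.
Hypothesis phi_subst : is_substitution rho L phi.

Notation Om := (Omega rho L phi).

Lemma support_translate (t : tile k n) v y :
  support rho (translate t v) (vadd y v) <-> support rho t y.
Proof.
  unfold support, translate; simpl.
  replace (vsub (vadd y v) (vadd (snd t) v)) with (vsub y (snd t)) by vec_ring.
  reflexivity.
Qed.

Lemma support_translate_iff (t : tile k n) v y :
  support rho (translate t v) y <-> support rho t (vsub y v).
Proof.
  rewrite <- (support_translate t v (vsub y v)).
  replace (vadd (vsub y v) v) with y by vec_ring; reflexivity.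
Qed.

Lemma interior_translate (t : tile k n) v y :
  interior (support rho t) y -> interior (support rho (translate t v)) (vadd y v).
Proof.
  intros [r [Hr H]]; exists r; split; [exact Hr|]; intros z Hz.
  apply support_translate_iff, H; unfold vdist in *.
  replace (vsub (vsub z v) y) with (vsub z (vadd y v)) by vec_ring; exact Hz.
Qed.

Lemma interior_sub (A : Rn n -> Prop) x : interior A x -> A x.
Proof. intros [r [Hr H]]; apply H; rewrite vdist_refl; exact Hr. Qed.

Lemma translate_vzero (t : tile k n) : translate t vzero = t.
Proof.
  destruct t as [i v]; unfold translate; simpl; f_equal; vec_ring.
Qed.

Lemma translate_vadd (t : tile k n) u v : translate (translate t u) v = translate t (vadd u v).
Proof. unfold translate; simpl; f_equal; vec_ring. Qed.

Lemma translate_inj (t t' : tile k n) v : translate t v = translate t' v -> t = t'.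
Proof.
  intro H; rewrite <- (translate_vzero t), <- (translate_vzero t').
  replace (vzero : Rn n) with (vadd v (vsub vzero v)) by vec_ring.
  rewrite <- !translate_vadd, H; reflexivity.
Qed.

(** As [g] is an arbitrary function of predicates, identities between tilings are needed as
    equalities in order to rewrite under it. *)
Lemma tset_ext (T S : tset k n) : (forall t, T t <-> S t) -> T = S.
Proof.
  intro H; apply functional_extensionality; intro t; apply propositional_extensionality, H.
Qed.

Lemma tminus_tminus (T : tset k n) u v : tminus (tminus T u) v = tminus T (vadd u v).
Proof.
  apply functional_extensionality; intro t; unfold tminus; simpl; do 2 f_equal; vec_ring.
Qed.

Lemma Omega_tminus T v : Om T -> Om (tminus T v).
Proof.
  intros [[Hcov Hdisj] Hall]; split; [split|].
  - intro x; destruct (Hcov (vadd x v)) as [t [H1 H2]].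
    exists (translate t (vsub vzero v)); split.
    + unfold tminus, translate; simpl.
      replace (vadd (vadd (snd t) (vsub vzero v)) v) with (snd t) by vec_ring.
      destruct t; exact H1.
    + apply support_translate_iff.
      replace (vsub x (vsub vzero v)) with (vadd x v) by vec_ring; exact H2.
  - intros t t' x Ht Ht' Hne H1 H2.
    apply (Hdisj (translate t v) (translate t' v) (vadd x v) Ht Ht');
      [intro H; apply Hne, (translate_inj _ _ _ H)| |]; apply interior_translate; assumption.
  - intros P HP; destruct (Hall (map (fun t => translate t v) P)) as [m [i [u Hu]]].
    + intros t Ht; apply in_map_iff in Ht; destruct Ht as [t' [<- Ht']]; exact (HP t' Ht').
    + exists m, i, (vsub u v); intros t Ht.
      replace (vsub (snd t) (vsub u v)) with (vsub (snd (translate t v)) u)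
        by (simpl; vec_ring).
      exact (Hu _ (in_map (fun t => translate t v) P t Ht)).
Qed.

(** * The substitution acts on [Omega] *)

Lemma linear_vsub u v : L (vsub u v) = vsub (L u) (L v).
Proof.
  destruct L_expanding as [[LD LZ] _].
  replace (vsub u v) with (vadd u (vscal (-1) v)) by vec_ring.
  rewrite LD, LZ; vec_ring.
Qed.

Lemma support_image i t y : In t (phi i) -> support rho t y -> exists z, rho i z /\ y = L z.
Proof. intros Ht Hy; apply (phi_subst i); exists t; split; assumption. Qed.

(** Continuity pulls a ball around [L z] back to one around [z], and injectivity places it inside
    [B]. Thus an overlap of two substituted tiles descends to an overlap of the tiles they come
    from. *)
Lemma interior_image (A : Rn n -> Prop) (B : Rn n -> Prop) z :
  (forall y, A y -> exists x, B x /\ y = L x) -> interior A (L z) -> interior B z.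
Proof.
  intros HAB [r [Hr H]].
  destruct L_expanding as [linL [Linj _]].
  destruct (linear_bounded n L linL) as [K [K0 HK]].
  exists (r / K); split; [apply Rdiv_lt_0_compat; lra|]; intros x Hx.
  destruct (HAB (L x)) as [x' [H1 H2]].
  - apply H; unfold vdist in *; rewrite <- linear_vsub.
    eapply Rle_lt_trans; [apply HK|].
    replace r with (K * (r / K)) by (field; lra); apply Rmult_lt_compat_l; assumption.
  - apply Linj in H2; subst; exact H1.
Qed.

Lemma PhiSet_support t i v u y : In (fst t, u) (phi i) -> snd t = vadd u (L v) ->
  support rho t y -> exists z, support rho (i, v) z /\ y = L z.
Proof.
  intros Hin Et Hy; destruct L_expanding as [[LD _] _].
  destruct (support_image i (fst t, u) (vsub y (L v)) Hin) as [z [H1 H2]].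
  - unfold support in *; simpl.
    replace (vsub (vsub y (L v)) u) with (vsub y (snd t)) by (rewrite Et; vec_ring); exact Hy.
  - exists (vadd z v); split.
    + unfold support; simpl; replace (vsub (vadd z v) v) with z by vec_ring; exact H1.
    + rewrite LD, <- H2; vec_ring.
Qed.

Lemma Omega_PhiSet T : Om T -> Om (PhiSet L phi T).
Proof.
  intros [[Hcov Hdisj] Hall].
  destruct L_expanding as [[LD LZ] [Linj [Lsurj _]]].
  split; [split|].
  - intro x; destruct (Lsurj x) as [z <-].
    destruct (Hcov z) as [[i v] [H1 H2]].
    destruct (proj2 (proj1 (phi_subst i) (L (vsub z v)))) as [t [Ht1 Ht2]];
      [exists (vsub z v); split; [exact H2|reflexivity]|].
    exists (translate t (L v)); split.
    + exists i, v, (snd t); repeat split; [exact H1|destruct t; exact Ht1].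
    + apply support_translate_iff; rewrite <- linear_vsub; exact Ht2.
  - intros t t' x [i [v [u [H1 [H2 H3]]]]] [i' [v' [u' [H1' [H2' H3']]]]] Hne I1 I2.
    (* Two tiles with the same parent are separated by the substitution rule; with different
       parents, an overlap pulls back through [L] to an overlap in [T]. *)
    destruct (classic ((i, v) = (i', v'))) as [E|E].
    + injection E as <- <-.
      assert (Et : t = translate (fst t, u) (L v)) by (destruct t; unfold translate; simpl in *; congruence).
      assert (Et' : t' = translate (fst t', u') (L v)) by (destruct t'; unfold translate; simpl in *; congruence).
      assert (back : forall s w, interior (support rho (translate s w)) x ->
                interior (support rho s) (vsub x w)).
      { intros s w Hs; apply (interior_translate _ (vsub vzero w)) in Hs.
        rewrite translate_vadd in Hs.
        replace (vadd w (vsub vzero w)) with (vzero : Rn n) in Hs by vec_ring.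
        rewrite translate_vzero in Hs.
        replace (vsub x w) with (vadd x (vsub vzero w)) by vec_ring; exact Hs. }
      rewrite Et in I1; rewrite Et' in I2.
      apply (proj2 (proj2 (phi_subst i)) (fst t, u) (fst t', u') (vsub x (L v)) H2 H2');
        [|apply back; exact I1|apply back; exact I2].
      intro H; apply Hne; rewrite Et, Et', H; reflexivity.
    + destruct (Lsurj x) as [z <-].
      apply (Hdisj (i, v) (i', v') z H1 H1' E).
      * apply interior_image with (A := support rho t); [|exact I1].
        intros y Hy; exact (PhiSet_support t i v u y H2 H3 Hy).
      * apply interior_image with (A := support rho t'); [|exact I2].
        intros y Hy; exact (PhiSet_support t' i' v' u' y H2' H3' Hy).
  - intros P HP.
    (* [Q] collects the parents of the tiles of [P]; a supertile of level [m] containing [Q] yields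
       one of level [S m] containing [P]. *)
    assert (HQ : exists Q, (forall s, In s Q -> T s) /\ forall t, In t P ->
      exists i v u, In (i, v) Q /\ In (fst t, u) (phi i) /\ snd t = vadd u (L v)).
    { clear - HP; induction P as [|t P IH]; [exists nil; split; intros ? []|].
      destruct IH as [Q [HQ1 HQ2]]; [intros s Hs; apply HP; right; exact Hs|].
      destruct (HP t (or_introl eq_refl)) as [i [v [u [H1 [H2 H3]]]]].
      exists ((i, v) :: Q); split.
      - intros s [<-|Hs]; [exact H1|exact (HQ1 s Hs)].
      - intros s [<-|Hs].
        + exists i, v, u; repeat split; [left; reflexivity|exact H2|exact H3].
        + destruct (HQ2 s Hs) as [i' [v' [u' [Q1 Q2]]]].
          exists i', v', u'; split; [right; exact Q1|exact Q2]. }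
    destruct HQ as [Q [HQ1 HQ2]]; destruct (Hall Q HQ1) as [m [j [w Hw]]].
    exists (S m), j, (L w); intros t Ht.
    destruct (HQ2 t Ht) as [i [v [u [H1 [H2 H3]]]]].
    exists i, (vsub v w), u; simpl; repeat split; [exact (Hw _ H1)|exact H2|].
    rewrite H3, linear_vsub; vec_ring.
Qed.

Lemma PhiSet_tminus T v : PhiSet L phi (tminus T v) = tminus (PhiSet L phi T) (L v).
Proof.
  destruct L_expanding as [[LD _] _].
  apply tset_ext; intro t; split; intros [i [w [u [H1 [H2 H3]]]]].
  - exists i, (vadd w v), u; simpl; repeat split; [exact H1|exact H2|].
    rewrite H3, LD; vec_ring.
  - simpl in *; exists i, (vsub w v), u; unfold tminus; simpl; repeat split; [|exact H2|].
    + replace (vadd (vsub w v) v) with w by vec_ring; exact H1.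
    + rewrite linear_vsub; replace (snd t) with (vsub (vadd (snd t) (L v)) (L v)) by vec_ring.
      rewrite H3; vec_ring.
Qed.

(** * Agreement of tilings on a region *)

Definition agree_on (K : Rn n -> Prop) (T S : tset k n) : Prop :=
  forall t y, K y -> support rho t y -> (T t <-> S t).

Definition ball (r : R) (y : Rn n) : Prop := vnorm y <= r.

Lemma agree_on_sub (K K' : Rn n -> Prop) T S :
  (forall y, K' y -> K y) -> agree_on K T S -> agree_on K' T S.
Proof. intros HK H t y Hy; exact (H t y (HK y Hy)). Qed.

Lemma agree_on_sym K T S : agree_on K T S -> agree_on K S T.
Proof. intros H t y Hy Ht; symmetry; exact (H t y Hy Ht). Qed.

Lemma agree_on_trans K T S U : agree_on K T S -> agree_on K S U -> agree_on K T U.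
Proof. intros H1 H2 t y Hy Ht; rewrite (H1 t y Hy Ht); exact (H2 t y Hy Ht). Qed.

Lemma agree_on_tminus K T S v :
  agree_on K T S -> agree_on (fun y => K (vadd y v)) (tminus T v) (tminus S v).
Proof.
  intros H t y Hy Ht; apply (H (translate t v) (vadd y v) Hy), support_translate, Ht.
Qed.

Lemma agree_on_ball_tminus r T S v :
  agree_on (ball (r + vnorm v)) T S -> agree_on (ball r) (tminus T v) (tminus S v).
Proof.
  intro H; apply agree_on_sub with (2 := agree_on_tminus _ _ _ v H).
  intros y Hy; unfold ball in *; assert (H1 := vnorm_triangle n y v); lra.
Qed.

(** A tile of the substituted tiling that contains [L z] has a parent containing [z]. Regions are
    arbitrary sets because [L] need not map balls to balls. *)
Lemma agree_on_PhiSet K T S : agree_on K T S ->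
  agree_on (fun y => exists z, K z /\ y = L z) (PhiSet L phi T) (PhiSet L phi S).
Proof.
  intros H; destruct L_expanding as [_ [Linj _]].
  assert (half : forall T S, agree_on K T S -> forall t y, (exists z, K z /\ y = L z) ->
    support rho t y -> PhiSet L phi T t -> PhiSet L phi S t).
  { clear T S H; intros T S H t y [z [Hz ->]] Ht [i [v [u [H1 [H2 H3]]]]].
    exists i, v, u; repeat split; [|exact H2|exact H3].
    destruct (PhiSet_support t i v u _ H2 H3 Ht) as [z' [H4 H5]].
    apply Linj in H5; subst z'; exact (proj1 (H (i, v) z Hz H4) H1). }
  intros t y Hy Ht; split; [apply (half T S H t y)|apply (half S T (agree_on_sym _ _ _ H) t y)];
    assumption.
Qed.

Lemma agree_on_iter_PhiSet m K T S : agree_on K T S ->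
  agree_on (fun y => exists z, K z /\ y = Nat.iter m L z)
    (Nat.iter m (PhiSet L phi) T) (Nat.iter m (PhiSet L phi) S).
Proof.
  intro H; induction m as [|m IH]; simpl.
  - apply agree_on_sub with (2 := H); intros y [z [Hz ->]]; exact Hz.
  - apply agree_on_sub with (2 := agree_on_PhiSet _ _ _ IH).
    intros y [z [Hz ->]]; exists (Nat.iter m L z); split; [exists z; auto|reflexivity].
Qed.

Lemma Omega_iter_PhiSet m T : Om T -> Om (Nat.iter m (PhiSet L phi) T).
Proof. intro H; induction m as [|m IH]; simpl; [exact H|exact (Omega_PhiSet _ IH)]. Qed.

Lemma iter_PhiSet_tminus m T v : Nat.iter m (PhiSet L phi) (tminus T v) =
  tminus (Nat.iter m (PhiSet L phi) T) (Nat.iter m L v).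
Proof. induction m as [|m IH]; simpl; [reflexivity|now rewrite IH, PhiSet_tminus]. Qed.

(** * Patches and sequential compactness of [Omega] *)

Lemma prototile_bound : exists D, 0 < D /\ forall i y, rho i y -> vnorm y <= D.
Proof.
  clear - rho_prototile; revert rho rho_prototile; induction k as [|k' IH]; intros rho' H.
  - exists 1; split; [lra|intro i; inversion i].
  - destruct (IH (fun i => rho' (Fin.FS i)) (fun i => H (Fin.FS i))) as [D [D0 HD]].
    destruct (H Fin.F1) as [[M HM] _].
    exists (D + Rabs M); assert (H1 := Rabs_pos M); assert (H2 := Rle_abs M).
    split; [lra|]; apply (fin_S_ind k' (fun i => forall y, rho' i y -> vnorm y <= D + Rabs M)).
    + intros y Hy; specialize (HM y Hy); lra.
    + intros i y Hy; specialize (HD i y Hy); lra.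
Qed.

(* Patches are recorded relative to a reference point [q t] of one of their tiles. *)
Lemma FLC_relative_patches (q : tile k n -> Rn n) r : FLC rho L phi ->
  (forall t v, q (translate t v) = vadd (q t) v) -> 0 < r ->
  exists Qs : list (list (tile k n)), forall T t x, Om T -> T t -> meets rho t x r ->
    exists Q, In Q Qs /\
      forall s, T s /\ meets rho s x r <-> In (translate s (vsub vzero (q t))) Q.
Proof.
  intros Hflc Hq Hr; destruct (Hflc r Hr) as [Ps HPs].
  exists (flat_map (fun P => map (fun t => map (fun s => translate s (vsub vzero (q t))) P) P) Ps).
  intros T t x HT Ht Hm; destruct (HPs T HT x) as [P [u [HP1 HP2]]].
  set (t0 := translate t (vsub vzero u)).
  assert (Hin : forall s, T s /\ meets rho s x r <-> In (translate s (vsub vzero u)) P).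
  { intro s; rewrite HP2; unfold translate.
    replace (vadd (snd s) (vsub vzero u)) with (vsub (snd s) u) by vec_ring; reflexivity. }
  assert (Ht0 : In t0 P) by (apply Hin; auto).
  exists (map (fun s => translate s (vsub vzero (q t0))) P); split.
  - apply in_flat_map; exists P; split; [exact HP1|].
    apply (in_map (fun t => map (fun s => translate s (vsub vzero (q t))) P) P t0 Ht0).
  - assert (Eq : forall s : tile k n, translate (translate s (vsub vzero u)) (vsub vzero (q t0)) =
                  translate s (vsub vzero (q t))).
    { intro s; rewrite translate_vadd; f_equal; unfold t0; rewrite Hq; vec_ring. }
    intro s; rewrite Hin, in_map_iff; split.
    + intro Hs; exists (translate s (vsub vzero u)); split; [apply Eq|exact Hs].
    + intros [s' [H1 H2]]; rewrite <- Eq in H1; apply translate_inj in H1; subst s'; exact H2.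
Qed.

Hypothesis phi_FLC : FLC rho L phi.

(** FLC leaves finitely many patches of each radius relative to the tile at the origin, so a
    diagonal subsequence makes them all eventually constant. Only the position of that tile still
    varies, in a bounded set, and a further subsequence makes it converge; the small vectors [w j]
    absorb the rest. *)
Lemma Omega_seq_compact (Ts : nat -> tset k n) : (forall j, Om (Ts j)) ->
  exists T s w, Om T /\ increasing s /\ converges w vzero /\
    forall r, exists J, forall j, (J <= j)%nat -> agree_on (ball r) T (tminus (Ts (s j)) (w j)).
Proof.
  intro HTs.
  destruct prototile_bound as [D [D0 HD]].
  assert (org : forall j, {t | Ts j t /\ support rho t vzero}).
  { intro j; apply constructive_indefinite_description, (proj1 (proj1 (HTs j))). }
  set (v := fun j => snd (proj1_sig (org j))).
  assert (patches : forall m : nat, {Qs : list (list (tile k n)) | forall T t x, Om T -> T t ->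
    meets rho t x (INR m + 1) -> exists Q, In Q Qs /\ forall s,
      T s /\ meets rho s x (INR m + 1) <-> In (translate s (vsub vzero (snd t))) Q}).
  { intro m; apply constructive_indefinite_description, FLC_relative_patches;
      [exact phi_FLC|reflexivity|assert (H := pos_INR m); lra]. }
  (* The radius is [INR m + 1] rather than [INR m] to leave room for a later translation by [w j],
     of norm less than 1. *)
  assert (patch : forall m j, {Q | In Q (proj1_sig (patches m)) /\ forall s,
      Ts j s /\ meets rho s vzero (INR m + 1) <-> In (translate s (vsub vzero (v j))) Q}).
  { intros m j; apply constructive_indefinite_description, (proj2_sig (patches m)).
    - apply HTs.
    - exact (proj1 (proj2_sig (org j))).
    - exists vzero; split; [exact (proj2 (proj2_sig (org j)))|].
      rewrite vdist_refl; assert (H := pos_INR m); lra. }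
  destruct (diagonal_subsequence _ (fun m j => proj1_sig (patch m j))) as [s1 [Hs1 HQ]].
  { intro m; exists (proj1_sig (patches m)); intro j; exact (proj1 (proj2_sig (patch m j))). }
  destruct (bolzano_weierstrass n (fun j => v (s1 j)) D) as [s2 [v0 [Hs2 Hv0]]].
  { intro j; assert (H := HD _ _ (proj2 (proj2_sig (org (s1 j))))); fold (v (s1 j)) in H.
    rewrite <- vdist_vzero, vdist_sym; exact H. }
  (* Translating by [w j] moves the chosen tile at the origin to the limit position [v0] for all
     [j], so that the patches literally coincide. *)
  set (s := fun j => s1 (s2 j)); set (w := fun j => vsub (v (s j)) v0).
  assert (Hw : converges w vzero).
  { intros eps He; destruct (Hv0 eps He) as [J HJ]; exists J; intros j Hj.
    rewrite vdist_vzero; exact (HJ j Hj). }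
  assert (Hs : increasing s).
  { assert (mono : forall a b, (a < b)%nat -> (s1 a < s1 b)%nat).
    { intros a b Hab; induction Hab as [|b Hab IH]; [apply Hs1|].
      assert (H := Hs1 b); lia. }
    intro j; apply mono, Hs2. }
  assert (stable : forall m, exists Q J, forall j, (J <= j)%nat ->
    forall t y, ball (INR m) y -> support rho t y ->
      (tminus (Ts (s j)) (w j) t <-> In (translate t (vsub vzero v0)) Q)).
  { intro m; destruct (HQ m) as [Q HQm]; destruct (Hw 1 Rlt_0_1) as [J HJ].
    exists Q, (m + J)%nat; intros j Hj t y Hy Ht.
    assert (H1 := increasing_ge s2 Hs2 j).
    specialize (HQm (s2 j)); rewrite <- HQm by lia.
    replace (translate t (vsub vzero v0))
      with (translate (translate t (w j)) (vsub vzero (v (s1 (s2 j)))))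
      by (rewrite translate_vadd; f_equal; unfold w, s; vec_ring).
    rewrite <- (proj2 (proj2_sig (patch m (s1 (s2 j))))).
    split; [|intros [H _]; exact H].
    intro H; split; [exact H|]; exists (vadd y (w j)); split.
    - apply support_translate; exact Ht.
    - rewrite vdist_vzero; eapply Rle_trans; [apply vnorm_triangle|].
      assert (H2 : vdist (w j) vzero < 1) by (apply HJ; lia).
      rewrite vdist_vzero in H2; unfold ball in Hy; lra. }
  (* The limit consists of the tiles that are eventually present. Each requirement of [Omega]
     concerns one point or a finite list of tiles, so it is inherited from a late translate. *)
  set (T := fun t => exists J, forall j, (J <= j)%nat -> tminus (Ts (s j)) (w j) t).
  assert (HT : forall r, exists J, forall j, (J <= j)%nat ->
     agree_on (ball r) T (tminus (Ts (s j)) (w j))).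
  { intro r; destruct (INR_unbounded r) as [m Hm]; destruct (stable m) as [Q [J HJ]].
    exists J; intros j Hj t y Hy Ht.
    assert (Hy' : ball (INR m) y) by (unfold ball in *; lra).
    rewrite (HJ j Hj t y Hy' Ht); split.
    - intros [J' HJ']; specialize (HJ' (J + J')%nat ltac:(lia)).
      apply (HJ (J + J')%nat ltac:(lia) t y Hy' Ht); exact HJ'.
    - intro HQ'; exists J; intros j' Hj'; apply (HJ j' Hj' t y Hy' Ht); exact HQ'. }
  exists T, s, w; split; [|split; [exact Hs|split; [exact Hw|exact HT]]].
  assert (HOm : forall j, Om (tminus (Ts (s j)) (w j))) by (intro j; apply Omega_tminus, HTs).
  split; [split|].
  - intro x; destruct (HT (vnorm x)) as [J HJ].
    destruct (proj1 (proj1 (HOm J)) x) as [t [H1 H2]].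
    exists t; split; [|exact H2].
    apply (HJ J (le_n J) t x); [apply Rle_refl|exact H2|exact H1].
  - intros t t' x Ht Ht' Hne I1 I2; destruct (HT (vnorm x)) as [J HJ].
    apply (proj2 (proj1 (HOm J)) t t' x); try assumption.
    + apply (HJ J (le_n J) t x); [apply Rle_refl|apply interior_sub, I1|exact Ht].
    + apply (HJ J (le_n J) t' x); [apply Rle_refl|apply interior_sub, I2|exact Ht'].
  - intros P HP.
    assert (HJ : exists J, forall t, In t P -> forall j, (J <= j)%nat -> tminus (Ts (s j)) (w j) t).
    { clear - HP; induction P as [|t P IH]; [exists O; intros t []|].
      destruct IH as [J1 H1]; [intros t' Ht'; apply HP; right; exact Ht'|].
      destruct (HP t (or_introl eq_refl)) as [J2 H2].
      exists (J1 + J2)%nat; intros t' [<-|Ht'] j Hj; [apply H2; lia|].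
      apply H1; [exact Ht'|lia]. }
    destruct HJ as [J HJ]; apply (proj2 (HOm J)); intros t Ht; apply HJ; [exact Ht|lia].
Qed.

Lemma agree_tclose delta T S w : 0 < delta -> vnorm w < delta ->
  agree_on (ball (1 / delta)) T (tminus S w) -> tclose rho delta T S.
Proof.
  intros Hd Hw H; exists vzero, w; rewrite vnorm_zero; split; [exact Hd|split; [exact Hw|]].
  intros t [y [H1 H2]]; rewrite vdist_vzero in H2.
  rewrite <- (H t y H2 H1); unfold tminus.
  replace (vadd (snd t) vzero) with (snd t) by vec_ring; destruct t; reflexivity.
Qed.

(** * The factor map and the rigidity of its fibers *)

Variables (X : MetricSpace) (act : Rn n -> X -> X) (g : tset k n -> X).
Hypothesis act_cont : continuous_action X act.
Hypothesis act_free : locally_free X act.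
Hypothesis g_factor : factor_map rho L phi X act g.
Hypothesis g_Phi : forall T T', Om T -> Om T' -> g T = g T' ->
  g (PhiSet L phi T) = g (PhiSet L phi T').

(** Otherwise some pairs agree on larger and larger balls while their images stay [eps] apart. Along
    a subsequence both members approach one limit tiling, where continuity brings both images within
    [eps / 2] of its image. *)
Lemma g_uniformly_continuous eps : 0 < eps -> exists r, 0 < r /\
  forall T S, Om T -> Om S -> agree_on (ball r) T S -> mdist X (g T) (g S) < eps.
Proof.
  intro He; apply NNPP; intro Hno.
  assert (bad : forall j : nat, {TS : tset k n * tset k n | Om (fst TS) /\ Om (snd TS) /\
     agree_on (ball (INR j + 1)) (fst TS) (snd TS) /\ eps <= mdist X (g (fst TS)) (g (snd TS))}).
  { intro j; apply constructive_indefinite_description, NNPP; intro Hj; apply Hno.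
    exists (INR j + 1); split; [assert (H := pos_INR j); lra|]; intros T S HT HS Hag.
    destruct (Rlt_dec (mdist X (g T) (g S)) eps) as [H|H]; [exact H|exfalso].
    apply Hj; exists (T, S); simpl; repeat (split; [assumption|]); lra. }
  destruct (Omega_seq_compact (fun j => fst (proj1_sig (bad j)))) as [T [s [w [HT [Hs [Hw Hag]]]]]].
  { intro j; exact (proj1 (proj2_sig (bad j))). }
  destruct g_factor as [_ [_ g_cont]].
  destruct (g_cont T (eps / 2) HT ltac:(lra)) as [delta [Hd Hg]].
  destruct (Hw delta Hd) as [J1 HJ1]; destruct (Hw 1 Rlt_0_1) as [J2 HJ2].
  destruct (Hag (1 / delta)) as [J3 HJ3]; destruct (INR_unbounded (1 / delta)) as [J4 HJ4].
  set (j := (J1 + J2 + J3 + J4)%nat).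
  specialize (HJ1 j ltac:(lia)); specialize (HJ2 j ltac:(lia)); specialize (HJ3 j ltac:(lia)).
  rewrite vdist_vzero in HJ1, HJ2.
  destruct (proj2_sig (bad (s j))) as [B1 [B2 [B3 B4]]].
  set (A := fst (proj1_sig (bad (s j)))) in *; set (B := snd (proj1_sig (bad (s j)))) in *.
  assert (HA : mdist X (g T) (g A) < eps / 2).
  { apply Hg; [exact B1|]; apply agree_tclose with (w j); assumption. }
  assert (HB : mdist X (g T) (g B) < eps / 2).
  { apply Hg; [exact B2|]; apply agree_tclose with (w j); [assumption..|].
    (* The two tilings agree up to radius [INR (s j) + 1], which exceeds [1 / delta] by more than
       the norm of [w j], so the same translation brings the second one close to [T] too. *)
    apply agree_on_trans with (1 := HJ3), agree_on_ball_tminus.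
    apply agree_on_sub with (2 := B3); intros y Hy; unfold ball in *.
    assert (H1 : INR J4 <= INR (s j)).
    { apply le_INR; assert (H := increasing_ge s Hs j); lia. }
    lra. }
  assert (H := mdist_tri X (g A) (g T) (g B)); rewrite (mdist_sym X (g A) (g T)) in H; lra.
Qed.

(** By compactness of [Omega] and of the annulus between [a] and [b], vectors displacing points less
    and less would converge to a [w] in the annulus fixing a point [g T]; as [0 < a], this [w] is
    nonzero. *)
Lemma displacement_bound a b :
  0 < a -> (forall v x, v <> vzero -> vnorm v <= b -> act v x <> x) ->
  exists eta, 0 < eta /\ forall T w, Om T -> a <= vnorm w <= b ->
    eta <= mdist X (g T) (act w (g T)).
Proof.
  intros Ha Hfree; apply NNPP; intro Hno.
  assert (bad : forall j : nat, {Tw : tset k n * Rn n | Om (fst Tw) /\ a <= vnorm (snd Tw) <= b /\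
     mdist X (g (fst Tw)) (act (snd Tw) (g (fst Tw))) < / (INR j + 1)}).
  { intro j; apply constructive_indefinite_description, NNPP; intro Hj; apply Hno.
    exists (/ (INR j + 1)); split.
    - apply Rinv_0_lt_compat; assert (H := pos_INR j); lra.
    - intros T w HT Hw; destruct (Rle_dec (/ (INR j + 1)) (mdist X (g T) (act w (g T)))) as [H|H];
        [exact H|exfalso].
      apply Hj; exists (T, w); simpl; repeat (split; [assumption|]); lra. }
  destruct (Omega_seq_compact (fun j => fst (proj1_sig (bad j)))) as [T [s [u [HT [Hs [Hu Hag]]]]]].
  { intro j; exact (proj1 (proj2_sig (bad j))). }
  destruct (bolzano_weierstrass n (fun j => snd (proj1_sig (bad (s j)))) b) as [s' [w [Hs' Hw]]].
  { intro j; exact (proj2 (proj1 (proj2 (proj2_sig (bad (s j)))))). }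
  set (Tj := fun j => fst (proj1_sig (bad (s (s' j))))).
  set (wj := fun j => snd (proj1_sig (bad (s (s' j))))).
  assert (Hbad : forall j, Om (Tj j) /\ a <= vnorm (wj j) <= b /\
     mdist X (g (Tj j)) (act (wj j) (g (Tj j))) < / (INR j + 1)).
  { intro j; destruct (proj2_sig (bad (s (s' j)))) as [B1 [B2 B3]].
    split; [exact B1|split; [exact B2|]]; eapply Rlt_le_trans; [exact B3|].
    apply Rinv_le_contravar; [assert (H := pos_INR j); lra|].
    apply Rplus_le_compat_r, le_INR.
    assert (H1 := increasing_ge s Hs (s' j)); assert (H2 := increasing_ge s' Hs' j); lia. }
  assert (Hg : forall eps, 0 < eps -> exists J, forall j, (J <= j)%nat -> mdist X (g T) (g (Tj j)) < eps).
  { intros eps He; destruct (proj2 (proj2 g_factor) T eps HT He) as [delta [Hd Hg]].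
    destruct (Hu delta Hd) as [J1 HJ1]; destruct (Hag (1 / delta)) as [J2 HJ2].
    exists (J1 + J2)%nat; intros j Hj; assert (H := increasing_ge s' Hs' j).
    apply Hg; [apply (proj1 (Hbad j))|].
    apply agree_tclose with (u (s' j)); [exact Hd| |apply HJ2; lia].
    rewrite <- vdist_vzero; apply HJ1; lia. }
  assert (Hnorm : a <= vnorm w <= b).
  { assert (near : forall eps, 0 < eps -> exists v, a <= vnorm v <= b /\ vdist v w < eps).
    { intros eps He; destruct (Hw eps He) as [J HJ]; exists (wj J); split;
        [apply (Hbad J)|apply HJ; lia]. }
    assert (vn : forall v, vnorm v <= vnorm w + vdist v w /\ vnorm w <= vnorm v + vdist v w).
    { intro v; rewrite <- (vdist_vzero _ v), <- (vdist_vzero _ w).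
      assert (H1 := vdist_tri n v w vzero); assert (H2 := vdist_tri n w v vzero).
      rewrite (vdist_sym _ w v) in H2; lra. }
    split; apply Rnot_lt_le; intro H.
    - destruct (near (a - vnorm w)) as [v [H1 H2]]; [lra|]; destruct (vn v); lra.
    - destruct (near (vnorm w - b)) as [v [H1 H2]]; [lra|]; destruct (vn v); lra. }
  apply (Hfree w (g T)); [intros ->; rewrite vnorm_zero in Hnorm; lra|apply Hnorm|].
  symmetry; apply (mdist_eq0 X), Rle_antisym; [|apply mdist_nonneg].
  apply Rnot_lt_le; intro Hpos; set (eps := mdist X (g T) (act w (g T))) in *.
  destruct act_cont as [_ [_ cont]].
  destruct (cont w (g T) (eps / 3) ltac:(lra)) as [delta [Hd Hact]].
  (* The distance from [g T] to [act w (g T)] is split in three through [g (Tj j)] and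
     [act (wj j) (g (Tj j))]; closeness to [g T] serves both the first part and the continuity of
     the action in the third. *)
  destruct (Hg (Rmin delta (eps / 3))) as [J1 HJ1]; [apply Rmin_glb_lt; lra|].
  destruct (Hw delta Hd) as [J2 HJ2]; destruct (INR_unbounded (3 / eps)) as [J3 HJ3].
  set (j := (J1 + J2 + J3)%nat); destruct (Hbad j) as [B1 [B2 B3]].
  specialize (HJ1 j ltac:(lia)).
  assert (M1 := Rmin_l delta (eps / 3)); assert (M2 := Rmin_r delta (eps / 3)).
  specialize (Hact (wj j) (g (Tj j))); rewrite vdist_sym in Hact.
  specialize (Hact (HJ2 j ltac:(lia)) ltac:(lra)).
  assert (Hinv : / (INR j + 1) < eps / 3).
  { assert (0 < 3 / eps) by (apply Rdiv_lt_0_compat; lra).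
    assert (INR J3 <= INR j) by (apply le_INR; lia).
    replace (eps / 3) with (/ (3 / eps)) by (field; lra).
    apply Rinv_lt_contravar; [apply Rmult_lt_0_compat|]; lra. }
  assert (T1 := mdist_tri X (g T) (g (Tj j)) (act w (g T))).
  assert (T2 := mdist_tri X (g (Tj j)) (act (wj j) (g (Tj j))) (act w (g T))).
  rewrite (mdist_sym X (act (wj j) _)) in T2; fold eps in T1; lra.
Qed.

Lemma g_iter_PhiSet m T T' : Om T -> Om T' -> g T = g T' ->
  g (Nat.iter m (PhiSet L phi) T) = g (Nat.iter m (PhiSet L phi) T').
Proof.
  intros HT HT' H; induction m as [|m IH]; simpl; [exact H|].
  apply g_Phi; [apply Omega_iter_PhiSet, HT|apply Omega_iter_PhiSet, HT'|exact IH].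
Qed.

(* A nonzero discrepancy [v] would be magnified by [Phi^m] to a vector [L^m v] of
   moderate size that almost fixes a point of [X]. *)
Lemma fiber_rigidity : exists r0 e0, 0 < r0 /\ 0 < e0 /\
  forall T T' S S' v, Om T -> Om T' -> Om S -> Om S' -> g T = g T' -> g S = g S' ->
    agree_on (ball r0) T S -> agree_on (ball r0) T' (tminus S' v) -> vnorm v < e0 -> v = vzero.
Proof.
  destruct act_free as [r [Hr Hfree]].
  destruct (linear_bounded n L (proj1 L_expanding)) as [K [K0 HK]].
  (* One application of [L] multiplies norms by at most [K], the ratio of the two ends of this
     window, so an orbit growing out of its lower end cannot jump over it. *)
  destruct (displacement_bound (r / (2 * K)) (r / 2)) as [eta [Heta Hdisp]].
  { apply Rdiv_lt_0_compat; lra. }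
  { intros v x Hv Hn; apply Hfree; [exact Hv|lra]. }
  destruct (g_uniformly_continuous (eta / 2) ltac:(lra)) as [q [Hq Hunif]].
  destruct (expanding_preimage_bound n L L_expanding) as [C [C0 HC]].
  (* Agreement up to [C * q] becomes agreement up to [q] after any number of substitutions; vectors
     shorter than [r / (2 * K)] start below the window. *)
  exists (C * q), (r / (2 * K)); split; [apply Rmult_lt_0_compat; lra|].
  split; [apply Rdiv_lt_0_compat; lra|].
  intros T T' S S' v HT HT' HS HS' Hg1 Hg2 Ha1 Ha2 Hv; apply NNPP; intro Hv0.
  assert (exit : exists m, r / (2 * K) <= vnorm (Nat.iter m L v) <= r / 2).
  { destruct (expanding_orbit_escapes n L v (r / (2 * K)) L_expanding Hv0) as [m Hm].
    induction m as [|m IH]; [simpl in Hm; lra|].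
    (* Descends to an exponent whose predecessor is still below the window; exponent 0 is excluded
       by the smallness of [v]. *)
    destruct (Rle_dec (r / (2 * K)) (vnorm (Nat.iter m L v))) as [H|H]; [exact (IH H)|].
    exists (Datatypes.S m); split; [exact Hm|]; simpl; eapply Rle_trans; [apply HK|].
    replace (r / 2) with (K * (r / (2 * K))) by (field; lra).
    apply Rmult_le_compat_l; lra. }
  destruct exit as [m Hm]; set (w := Nat.iter m L v) in *.
  assert (grow : forall A B, agree_on (ball (C * q)) A B -> agree_on (ball q)
     (Nat.iter m (PhiSet L phi) A) (Nat.iter m (PhiSet L phi) B)).
  { intros A B H; apply agree_on_sub with (2 := agree_on_iter_PhiSet m _ _ _ H).
    intros y Hy; destruct (HC m y) as [z [H1 H2]]; exists z; split; [|auto].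
    unfold ball in *; eapply Rle_trans; [exact H2|]; apply Rmult_le_compat_l; lra. }
  assert (O1 := Omega_iter_PhiSet m _ HT); assert (O2 := Omega_iter_PhiSet m _ HT').
  assert (O3 := Omega_iter_PhiSet m _ HS); assert (O4 := Omega_iter_PhiSet m _ HS').
  assert (D1 := Hunif _ _ O1 O3 (grow _ _ Ha1)).
  apply grow in Ha2; rewrite iter_PhiSet_tminus in Ha2; fold w in Ha2.
  assert (D2 := Hunif _ _ O2 (Omega_tminus _ w O4) Ha2).
  rewrite (proj1 (proj2 g_factor)) in D2 by exact O4.
  rewrite <- (g_iter_PhiSet m T T'), <- (g_iter_PhiSet m S S') in D2 by assumption.
  specialize (Hdisp _ w O3 Hm).
  assert (H := mdist_tri X (g (Nat.iter m (PhiSet L phi) S)) (g (Nat.iter m (PhiSet L phi) T))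
    (act w (g (Nat.iter m (PhiSet L phi) S)))).
  rewrite (mdist_sym X _ (g (Nat.iter m (PhiSet L phi) T))) in H; lra.
Qed.

End Tilings.

(** * Finiteness of the set of displacements *)

Lemma finite_of_injective_coloring A C (O : A -> Prop) (l : list C) (color : A -> C -> Prop) :
  (forall x, O x -> exists c, In c l /\ color x c) ->
  (forall x y c, color x c -> color y c -> x = y) ->
  exists s, forall x, O x -> In x s.
Proof.
  intros Hex Hinj.
  assert (H : exists s, forall x c, In c l -> color x c -> In x s).
  { clear Hex; induction l as [|c l [s Hs]]; [exists nil; intros x c []|].
    destruct (classic (exists x, color x c)) as [[x Hx]|Hno].
    - exists (x :: s); intros y c' [<-|Hc'] Hy; [left; exact (Hinj x y c Hx Hy)|].
      right; exact (Hs y c' Hc' Hy).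
    - exists s; intros y c' [<-|Hc'] Hy; [exfalso; apply Hno; exists y; exact Hy|].
      exact (Hs y c' Hc' Hy). }
  destruct H as [s Hs]; exists s; intros x Hx; destruct (Hex x Hx) as [c [H1 H2]].
  exact (Hs x c H1 H2).
Qed.

Theorem mainTheorem14 :
  forall (n k : nat) (rho : Fin.t k -> Rn n -> Prop) (L : Rn n -> Rn n)
         (phi : Fin.t k -> list (tile k n)),
    (forall i, is_prototile (rho i)) ->
    expanding_iso L ->
    is_substitution rho L phi ->
    primitive_subst L phi ->
    aperiodic rho L phi ->
    FLC rho L phi ->
  forall (X : MetricSpace) (act : Rn n -> X -> X),
    m_compact X ->
    continuous_action X act ->
    locally_free X act ->
  forall g : tset k n -> X,
    factor_map rho L phi X act g ->
    (forall T T', Omega rho L phi T -> Omega rho L phi T' -> g T = g T' ->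
       g (PhiSet L phi T) = g (PhiSet L phi T')) ->
  forall p : tile k n -> Rn n,
    puncture rho p ->
    exists l : list (Rn n), forall x, Oset rho L phi g p x -> In x l.
Proof.
  intros n k rho L phi Hrho HL Hphi _ _ Hflc X act _ Hact Hfree g Hg HgPhi p [Hp1 Hp2].
  destruct (fiber_rigidity n k rho L phi Hrho HL Hphi Hflc X act g Hact Hfree Hg HgPhi)
    as [r0 [e0 [Hr0 [He0 Hrigid]]]].
  destruct (prototile_bound n k rho Hrho) as [D [D0 HD]].
  assert (Hdiam : forall t y, support rho t y -> vdist (p t) y <= 2 * D).
  { intros t y Hy; unfold vdist.
    replace (vsub (p t) y) with (vsub (vsub (p t) (snd t)) (vsub y (snd t))) by vec_ring.
    eapply Rle_trans; [apply vnorm_vsub_le|].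
    assert (H1 := HD _ _ (Hp1 t)); assert (H2 := HD _ _ Hy); lra. }
  (* A patch of [T'] known around [p t'] will be used around [p t]. Overlapping tiles have punctures
     at most [4 * D] apart, so radius [r0] survives this shift. *)
  set (r1 := r0 + 4 * D).
  destruct (FLC_relative_patches n k rho L phi p r1 Hflc Hp2 ltac:(unfold r1; lra)) as [Qs HQs].
  destruct (net_ball n (4 * D) (e0 / 2) ltac:(lra)) as [cs Hcs].
  set (patch := fun (T : tset k n) t Q => forall s,
    T s /\ meets rho s (p t) r1 <-> In (translate s (vsub vzero (p t))) Q).
  (* A displacement is coloured by its two relative patches and a net point within [e0 / 2]. The
     colouring is a relation because one displacement may arise from many pairs of tilings. *)
  apply finite_of_injective_coloring with (C := (list (tile k n) * list (tile k n) * Rn n)%type)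
    (l := list_prod (list_prod Qs Qs) cs)
    (color := fun x c => exists T T' t t',
       Omega rho L phi T /\ Omega rho L phi T' /\ g T = g T' /\
       patch T t (fst (fst c)) /\ patch T' t' (snd (fst c)) /\
       vsub (p t) (p t') = x /\ vnorm x <= 4 * D /\ vdist x (snd c) < e0 / 2).
  - intros x [T [T' [HT [HT' [HgT [t [t' [Ht [Ht' [[y [I1 I2]] Hx]]]]]]]]]].
    assert (Hself : forall s, meets rho s (p s) r1).
    { intro s; exists (p s); split; [apply Hp1|rewrite vdist_refl; unfold r1; lra]. }
    destruct (HQs T t (p t) HT Ht (Hself t)) as [Q [HQ1 HQ2]].
    destruct (HQs T' t' (p t') HT' Ht' (Hself t')) as [Q' [HQ1' HQ2']].
    assert (Hxn : vnorm x <= 4 * D).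
    { rewrite <- Hx; apply interior_sub in I1; apply interior_sub in I2.
      assert (H := vdist_tri n (p t) y (p t')); rewrite (vdist_sym n y) in H.
      assert (H1 := Hdiam t y I1); assert (H2 := Hdiam t' y I2); unfold vdist in *; lra. }
    destruct (Hcs x Hxn) as [c [Hc1 Hc2]].
    exists (Q, Q', c); split; [apply in_prod; [apply in_prod|]; assumption|].
    exists T, T', t, t'; repeat (split; [assumption|]); assumption.
  - intros x y [[Q Q'] c] [T [T' [t [t' [HT [HT' [Hg1 [P1 [P1' [Hx [Hxn Hxc]]]]]]]]]]]
      [S [S' [s [s' [HS [HS' [Hg2 [P2 [P2' [Hy [Hyn Hyc]]]]]]]]]]]; simpl in *.
    assert (patch_agree : forall A B a b P, patch A a P -> patch B b P ->
      agree_on n k rho (ball n r1) (tminus A (p a)) (tminus B (p b))).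
    { intros A B a b P HA HB u z Hz Hu; unfold ball in Hz.
      assert (half : forall E e, patch E e P -> (tminus E (p e) u <-> In u P)).
      { intros E e HE; assert (H := HE (translate u (p e))); rewrite translate_vadd in H.
        replace (vadd (p e) (vsub vzero (p e))) with (vzero : Rn n) in H by vec_ring.
        rewrite translate_vzero in H; rewrite <- H; split; [|intros [H1 _]; exact H1].
        intro H1; split; [exact H1|]; exists (vadd z (p e)); split.
        - apply support_translate, Hu.
        - unfold vdist; replace (vsub (vadd z (p e)) (p e)) with z by vec_ring; exact Hz. }
      rewrite (half A a HA), (half B b HB); reflexivity. }
    assert (E : vsub x y = vzero).
    { apply (Hrigid (tminus T (p t)) (tminus T' (p t)) (tminus S (p s)) (tminus S' (p s)));
        try (apply Omega_tminus; assumption).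
      - rewrite !(proj1 (proj2 Hg)) by assumption; f_equal; exact Hg1.
      - rewrite !(proj1 (proj2 Hg)) by assumption; f_equal; exact Hg2.
      - apply agree_on_sub with (2 := patch_agree _ _ _ _ _ P1 P2).
        intros z Hz; unfold ball, r1 in *; lra.
      - rewrite tminus_tminus.
        (* Both primed tilings are now centred at the puncture of their own tile plus the same [x],
           so their equal patches around those punctures can be compared. *)
        replace (vadd (p s) (vsub x y)) with (vadd (p s') x) by (rewrite <- Hy; vec_ring).
        replace (p t) with (vadd (p t') x) by (rewrite <- Hx; vec_ring).
        rewrite <- !tminus_tminus; apply agree_on_ball_tminus.
        apply agree_on_sub with (2 := patch_agree _ _ _ _ _ P1' P2').
        intros z Hz; unfold ball, r1 in *; lra.
      - assert (H := vdist_tri n x c y); rewrite (vdist_sym n c y) in H.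
        unfold vdist in *; lra. }
    replace x with (vadd (vsub x y) y) by vec_ring; rewrite E; vec_ring.
Qed.
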